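(* Let $g\ge 2$ be an integer and let $d\in\{2g+1,2g+2\}$. Let $\alpha$ be any algebraic integer (including possibly $\alpha=0$) and let $F=\mathbb{Q}(\alpha)$. Then for every prime $p\equiv 1\pmod d$, the family $\mathcal{C}_\alpha\to\mathcal{S}^\circ$ of genus-$g$ curves $y^2=x^d+\alpha x+t$ is generically ordinary at each prime $\mathfrak{p}\mid p$ of $F$.
   Context: $\mathcal{O}_F$ is the ring of integers of $F=\mathbb{Q}(\alpha)$, $D_\alpha(t)=\mathrm{disc}_x(x^d+\alpha x+t)$, and $\mathcal{S}^\circ=\mathrm{Spec}\,\mathcal{O}_F[1/2,t,D_\alpha(t)^{-1}]$. The family $\mathcal{C}_\alpha\to\mathcal{S}^\circ$ is the family of smooth projective hyperelliptic curves of genus $g$ with affine equation $y^2=x^d+\alpha x+t$. A smooth projective curve of genus $g$ over a field of characteristic $p>0$ is ordinary if its Jacobian is an ordinary abelian variety, i.e. its Newton polygon has only slopes $0$ and $1$. For a prime $\mathfrak{p}\mid p$ of $\mathcal{O}_F$ with residue field $\kappa(\mathfrak{p})=\mathcal{O}_F/\mathfrak{p}$, put $\mathcal{S}^\circ_{\mathfrak{p}}=\mathcal{S}^\circ\times_{\mathrm{Spec}\,\mathcal{O}_F}\mathrm{Spec}\,\kappa(\mathfrak{p})$, a nonempty open subscheme of $\mathbb{A}^1_{\kappa(\mathfrak{p})}$ (the $t$-line). The family is generically ordinary at $\mathfrak{p}$ if its restriction to $\mathcal{S}^\circ_{\mathfrak{p}}$ has ordinary generic fiber, i.e. the curve $y^2=x^d+\bar\alpha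 x+t$ over the rational function field $\kappa(\mathfrak{p})(t)$ is ordinary, where $\bar\alpha=\alpha\bmod\mathfrak{p}$; equivalently, the ordinary locus in $\mathcal{S}^\circ_{\mathfrak{p}}$ is a nonempty open subset. *)

(* Defs.v *)
From HB Require Import structures.
From mathcomp Require Import all_boot all_order all_algebra all_field.
From mathcomp Require Import boolp.

Set Implicit Arguments.
Unset Strict Implicit.
Unset Printing Implicit Defensive.

Import Order.TTheory GRing.Theory Num.Theory.
Local Open Scope ring_scope.

Definition int_closure (F : fieldExtType rat) : {pred F} :=
  fun z => `[< integralOver (fun n : int => n%:~R : F) z >].
Arguments int_closure F : clear implicits.

Fact int_closure_subring (F : fieldExtType rat) :
  subring_closed (int_closure F).
Proof.
have E (z : F) : z \in int_closure F <->
    integralOver (intr : {rmorphism int -> F}) z.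
  by split=> [/asboolP | ?] //; apply/asboolP.
split=> [|x y /E hx /E hy|x y /E hx /E hy]; apply/E.
- exact: integral1.
- exact: integral_sub.
- exact: integral_mul.
Qed.

HB.instance Definition _ (F : fieldExtType rat) :=
  GRing.isSubringClosed.Build F (int_closure F) (@int_closure_subring F).

Record ring_of_integers (F : fieldExtType rat) := RingOfIntegers {
  roi_val :> F;
  roi_valP : roi_val \in int_closure F
}.

HB.instance Definition _ (F : fieldExtType rat) := [isSub for (@roi_val F)].
HB.instance Definition _ (F : fieldExtType rat) :=
  [Choice of ring_of_integers F by <:].
HB.instance Definition _ (F : fieldExtType rat) :=
  [SubChoice_isSubComNzRing of ring_of_integers F by <:].

(* The discriminant of a monic polynomial f of positive degree, where
   size f = deg f + 1. *)
Definition discriminant (R : comNzRingType) (f : {poly R}) : R :=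
  (-1) ^+ 'C((size f).-1, 2) * resultant f f^`().

Definition trinomial (R : comNzRingType) (d : nat) (a t : R) : {poly R} :=
  'X^d + a *: 'X + t%:P.

(* D_a(t) = disc_x (x^d + a x + t), a polynomial in t. *)
Definition disc_family (R : comNzRingType) (d : nat) (a : R) : {poly R} :=
  discriminant (trinomial d a%:P 'X).

(* Number of points over the finite field k of the smooth projective model of
   y^2 = f(x), for f squarefree of degree 2g+1 or 2g+2 and k of odd
   characteristic.  The chart at infinity (x, y) = (1/z, w/z^(g+1)) has
   equation w^2 = z^(2g+2) f(1/z), whose right-hand side is f`_(2g+2) at z = 0;
   hence one point at infinity if deg f = 2g+1, and as many as there are square
   roots of the leading coefficient if deg f = 2g+2. *)
Definition num_points (g : nat) (k : finFieldType) (f : {poly k}) : nat :=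
  addn #|[set P : k * k | P.2 ^+ 2 == f.[P.1]]|
       #|[set w : k | w ^+ 2 == f`_(g.*2.+2)]|.

(* L is the L-polynomial of the genus-g curve C : y^2 = f(x) over k = F_q, i.e.
   the numerator of its zeta function, or equivalently (Weil) the reciprocal
   characteristic polynomial of the q-Frobenius of the Jacobian of C:
   L(T) = prod_b (1 - b T), with #C(F_(q^n)) = q^n + 1 - sum_b b^n for all
   n > 0.  These conditions determine L. *)
Definition is_Lpoly (g : nat) (k : finFieldType) (f : {poly k})
    (L : {poly int}) : Prop :=
  size L = g.*2.+1 /\
  exists bs : seq algC,
    [/\ size bs = g.*2,
        map_poly (fun n : int => n%:~R : algC) L
          = \prod_(b <- bs) (1 - b *: 'X)
      & forall (n : nat) (kn : finFieldType) (iota : {rmorphism k -> kn}),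
          (0 < n)%N -> #|kn| = (#|k| ^ n)%N ->
          (num_points g (map_poly iota f))%:R
            = #|k|%:R ^+ n + 1 - \sum_(b <- bs) b ^+ n :> algC].

(* The p-adic valuation of a nonzero integer, normalized by v(q) = 1, where q
   is a power of p. *)
Definition vq (p q : nat) (a : int) : rat :=
  (logn p `|a|%N)%:R / (logn p q)%:R.

(* lam is the slope of an edge of the Newton polygon of L, i.e. of the lower
   convex hull of the points (i, v_q(L_i)) with L_i <> 0: the line of slope lam
   through two of these points lies below all of them. *)
Definition newton_slope (p q : nat) (L : {poly int}) (lam : rat) : Prop :=
  exists i j : nat,
    [/\ (i < j)%N, L`_i != 0, L`_j != 0,
        vq p q L`_j = vq p q L`_i + lam * (j%:R - i%:R)
      & forall l : nat, L`_l != 0 ->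
          vq p q L`_i + lam * (l%:R - i%:R) <= vq p q L`_l].

(* The Newton polygon of the Jacobian over k = F_q is that of its Frobenius, so
   the curve y^2 = f(x) is ordinary if the slopes of L are 0 and 1 only.  Here
   p is the characteristic of k. *)
Definition ordinary (p g : nat) (k : finFieldType) (f : {poly k}) : Prop :=
  exists2 L : {poly int}, is_Lpoly g f L &
    forall lam : rat, newton_slope p #|k| L lam -> lam = 0 \/ lam = 1.

Section Family.

Variables (F : fieldExtType rat) (d : nat) (alpha : ring_of_integers F).
Variable P : prime_idealr (ring_of_integers F).

Local Notation OF := (ring_of_integers F).
Local Notation kappa := {ideal_quot P}.

Definition residue (a : OF) : kappa := (\pi_kappa a)%qT.

(* The points with values in finite fields, that is, the closed points, of the
   fiber over P of S = Spec O_F[1/2, t, D_alpha(t)^-1]. *)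
Record fiber_point := FiberPoint {
  pt_field : finFieldType;
  pt_red : {rmorphism kappa -> pt_field};
  pt_t : pt_field;
  pt_two : (2%:R : pt_field) != 0;
  pt_disc :
    (map_poly (fun a : OF => pt_red (residue a)) (disc_family d alpha)).[pt_t]
      != 0
}.

Definition fiber_curve (s : fiber_point) : {poly pt_field s} :=
  trinomial d (pt_red s (residue alpha)) (pt_t s).

(* The open subsets of the fiber are the nonvanishing loci of the
   h in kappa[t], as kappa is a field. *)
Definition fiber_open (U : fiber_point -> Prop) : Prop :=
  exists h : {poly kappa},
    forall s : fiber_point, U s <-> (map_poly (pt_red s) h).[pt_t s] != 0.

(* The generic fiber over kappa(t) is ordinary if and only if the ordinary locus
   is open and nonempty, which is a condition on closed points, where Newton
   polygons are computed from Frobenius. *)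
Definition generically_ordinary (p g : nat) : Prop :=
  let U (s : fiber_point) := ordinary p g (fiber_curve s) in
  fiber_open U /\ exists s : fiber_point, U s.

End Family.

(* Main.v *)
(**
The L-polynomial of y^2 = f(x) over F_q is the L-function of the character
chi(h) = eta(Res(f, h)), with eta the quadratic character of F_q (divided by 1 - T
if deg f is even). Its logarithmic derivative yields the point counts, because each
monic h of degree n is divisible by exactly n of the polynomials
prod_(i < m) (X - x^(q^i)) with x^(q^m) = x. Poisson summation on F_q[x]/(f) gives
the functional equation; replacing the additive characters by an integer-valued
kernel keeps all sums in Z.

Counting points modulo p and Newton's identities give L = det(1 - T A) modulo p in
degrees at most g < p, where A is the Hasse-Witt matrix over F_q, and det A is a
power of the determinant of the Hasse-Witt matrix over F_p. By the functional
equation the slopes are 0 and 1 only if and only if p does not divide L_g. Hence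
ordinarity is the nonvanishing of a polynomial in t, namely the Hasse-Witt
determinant of x^d + a x + t. For p = 1 modulo d, in each row the diagonal entry has
strictly the highest degree in t, so this polynomial is nonzero. It remains to choose
t in a large finite extension of the residue field, which is finite because any
[F : Q] + 1 elements of O_F satisfy a linear relation with integer coefficients that
are not all divisible by p.
*)

Require Import Defs.
From HB Require Import structures.
From mathcomp Require Import all_boot all_order all_algebra all_field.
From mathcomp Require Import perm zify ring lra.
From mathcomp Require boolp.

Set Implicit Arguments.
Unset Strict Implicit.
Unset Printing Implicit Defensive.

Import Order.TTheory GRing.Theory Num.Theory.
Local Open Scope ring_scope.

(** * The quadratic character *)

(** [ordinary] asks for an integral polynomial that counts points over every finite extension, so
    its existence and functional equation come before any slope; both are read off from one
    character. Taking [chi(h)] to be the quadratic character of [det h(C)], with [C] a matrix of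
    characteristic polynomial [f], makes it multiplicative in [h] and, by Cayley-Hamilton, periodic
    modulo [f]. Separability of [f] makes it primitive, which is what Fourier inversion on
    [F_q[x]/(f)] requires. The fields with [q^m] elements all live in one algebraic closure, as
    fixed points of [x -> x^(q^m)], so norms and minimal polynomials are products over orbits.
    Newton's identities recover power sums from coefficients without division; the other direction
    divides by [1, ..., g], whence [g < p]. The Hasse-Witt determinant is formed before [t] is
    specialized, so one polynomial cuts out the ordinary locus at all closed points. Its degree in
    [t] is under control because [i p - j = d (i m) + (i - j)] when [p = m d + 1]. *)

Lemma half_pred_odd n : odd n -> (n.-1./2.*2 = n.-1)%N.
Proof. by case: n => // n /= /negPf n_even; rewrite -[RHS]odd_double_half n_even. Qed.

Lemma half_pred_gt0 Q : (1 < Q)%N -> odd Q -> (0 < Q.-1./2)%N.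
Proof. by move=> Q_gt1 Q_odd; have := half_pred_odd Q_odd; lia. Qed.

(* On a field with [Q] elements this is the quadratic character. It is used on the
   fixed points of [x |-> x ^+ Q] in a larger field, without naming the subfield. *)
Definition qchar (K : fieldType) (Q : nat) (z : K) : int :=
  if z == 0 then 0 else if z ^+ Q.-1./2 == 1 then 1 else -1.

Section QuadraticCharacter.

Variables (K : fieldType) (Q : nat).
Hypotheses (Q_gt1 : (1 < Q)%N) (Q_odd : odd Q) (K2 : (2 : K) != 0).

Lemma exprQE (z : K) : z ^+ Q = z * (z ^+ Q.-1./2) ^+ 2.
Proof. by rewrite -exprM muln2 half_pred_odd // -exprS prednK // ltnW. Qed.

Lemma qcharE (z : K) : z ^+ Q = z -> (qchar Q z)%:~R = z ^+ Q.-1./2.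
Proof.
rewrite exprQE /qchar; case: eqP => [->|/eqP z0].
  by rewrite expr0n gtn_eqF ?half_pred_gt0.
rewrite -[X in _ = X]mulr1 => /(mulfI z0) /eqP; rewrite sqrf_eq1.
case: eqP => [-> // | _] /= /eqP -> //.
Qed.

Lemma qchar_vals (z : K) : [\/ qchar Q z = 0, qchar Q z = 1 | qchar Q z = -1].
Proof.
rewrite /qchar; case: ifP => _; first by constructor 1.
by case: ifP => _; [constructor 2 | constructor 3].
Qed.

(** The difference of two signs is at most 2 in absolute value, and 2 is nonzero in [K]. Identities
    between character values can therefore be checked in [K], where the character is a power map. *)
Lemma sign_intr_inj (a b : int) :
  [\/ a = 0, a = 1 | a = -1] -> [\/ b = 0, b = 1 | b = -1] ->
  a%:~R = b%:~R :> K -> a = b.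
Proof.
have nz (c : int) : [\/ c = 1, c = -1, c = 2 | c = -2] -> (c%:~R == 0 :> K) = false.
  by case=> ->; rewrite ?mulrNz ?oppr_eq0 ?mulr1z ?oner_eq0 //; exact: negPf K2.
move=> ha hb /eqP; rewrite -subr_eq0 -intrB => ab; apply/eqP; rewrite -subr_eq0.
apply: contraTT ab; case: ha => ->; case: hb => -> // _; rewrite nz //.
all: by [constructor 1 | constructor 2 | constructor 3 | constructor 4].
Qed.

Lemma qchar_eq0 (z : K) : (qchar Q z == 0) = (z == 0).
Proof. by rewrite /qchar; case: ifP => //; case: ifP. Qed.

Lemma qchar0 : qchar Q (0 : K) = 0.
Proof. by rewrite /qchar eqxx. Qed.

Lemma qchar1 : qchar Q (1 : K) = 1.
Proof. by rewrite /qchar oner_eq0 expr1n eqxx. Qed.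

Lemma qcharM (z w : K) : z ^+ Q = z -> w ^+ Q = w ->
  qchar Q (z * w) = qchar Q z * qchar Q w.
Proof.
move=> zQ wQ; apply: sign_intr_inj; first exact: qchar_vals.
  by case: (qchar_vals z) => ->; case: (qchar_vals w) => ->;
    [constructor 1 | constructor 1 | constructor 1 | constructor 1
    | constructor 2 | constructor 3 | constructor 1 | constructor 3
    | constructor 2].
by rewrite intrM !qcharE // ?exprMn // zQ wQ.
Qed.

Lemma qcharX (z : K) n : z ^+ Q = z -> qchar Q (z ^+ n) = qchar Q z ^+ n.
Proof.
move=> zQ; elim: n => [|n IHn]; first by rewrite qchar1.
by rewrite !exprS qcharM ?IHn // -exprM mulnC exprM zQ.
Qed.

Lemma qchar_sqr (z : K) : z != 0 -> qchar Q z ^+ 2 = 1.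
Proof.
by rewrite -qchar_eq0; case: (qchar_vals z) => ->.
Qed.

End QuadraticCharacter.

Lemma qchar_rmorph (K K' : fieldType) (f : {rmorphism K -> K'}) Q (z : K) :
  qchar Q (f z) = qchar Q z.
Proof. by rewrite /qchar fmorph_eq0 -rmorphXn fmorph_eq1. Qed.

Lemma natr_card_finField (k : finFieldType) : #|k|%:R = 0 :> k.
Proof.
have [p _ pk] := finPcharP k; apply/eqP; rewrite -(dvdn_pcharf pk).
rewrite (card_pprimeChar pk : #|k| = _) dvdn_exp //.
rewrite -(ltn_exp2l _ _ (prime_gt1 (pcharf_prime pk))) -(card_pprimeChar pk).
exact: finNzRing_gt1.
Qed.

Lemma odd_pchar_two (R : nzRingType) p : p \in [pchar R] -> odd p -> (2 : R) != 0.
Proof.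
move=> charRp p_odd; rewrite -(dvdn_pcharf charRp) gtnNdvd //.
by have := prime_gt1 (pcharf_prime charRp); case: p p_odd charRp => [|[|[|]]].
Qed.

Section FiniteQuadraticCharacter.

Variable k : finFieldType.
Hypothesis k2 : (2 : k) != 0.
Local Notation q := #|k|.

Lemma odd_card_finField : odd q.
Proof.
have [p p_pr pk] := finPcharP k.
have -> : q = (p ^ logn p q)%N := card_pprimeChar pk.
rewrite oddX; case: (even_prime p_pr) => [p2|->]; last by rewrite orbT.
by have := k2; rewrite -p2 (pcharf0 pk) eqxx.
Qed.

Let q_gt1 : (1 < q)%N := finNzRing_gt1 k.
Let q_odd := odd_card_finField.

Lemma card_expr_half_eq1 :
  (#|[set z : k | z ^+ q.-1./2 == 1 :> k]%R| <= q.-1./2)%N.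
Proof.
rewrite cardE; apply: max_unity_roots (enum_uniq _); first exact: half_pred_gt0 q_gt1 q_odd.
by apply/allP => z; rewrite mem_enum inE unity_rootE.
Qed.

Lemma exists_nonsquare : exists2 w : k, w != 0 & qchar q w = -1.
Proof.
suff: exists w : k, ~~ ((w == 0) || (w ^+ q.-1./2 == 1)).
  by case=> w /norP[w0 /negPf w1]; exists w; rewrite // /qchar (negPf w0) w1.
apply/existsP; rewrite -negb_forall; apply/negP => /forallP all1.
have : (q <= #|((0 : k) |: [set z : k | z ^+ q.-1./2 == 1])%R|)%N.
  by rewrite -[X in (X <= _)%N]cardsT subset_leq_card //; apply/subsetP => z _; rewrite !inE all1.
rewrite cardsU1 => le_q; have := half_pred_odd q_odd.
have := half_pred_gt0 q_gt1 q_odd; have := leq_trans le_q (leq_add (leq_b1 _) card_expr_half_eq1).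
lia.
Qed.

Lemma sum_qchar : \sum_(z : k) qchar q z = 0.
Proof.
have [w w0 qw] := exists_nonsquare.
set S := LHS; suff : S = - S by lia.
rewrite {1}/S (reindex_inj (mulfI w0)) /= -mulN1r -qw mulr_sumr.
by apply: eq_bigr => z _; rewrite qcharM ?expf_card.
Qed.

(** The inequality [<=] holds for each [z], and both sides sum to [q] over [z], because squaring is
    a map from [k] to itself. Hence equality holds everywhere. *)
Lemma card_sqrt (z : k) : (#|[set w : k | w ^+ 2 == z]|)%:Z = 1 + qchar q z.
Proof.
have sq0 : #|[set w : k | w ^+ 2 == 0 :> k]| = 1%N.
  rewrite -[RHS](cards1 (0 : k)); apply: eq_card => w.
  by rewrite !inE sqrf_eq0.
have sq2 (y : k) : y != 0 -> #|[set w : k | w ^+ 2 == y ^+ 2]| = 2%N.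
  move=> y0; have /cards2P : exists x z : k, x != z /\ [set w : k | w ^+ 2 == y ^+ 2] = [set x; z].
    exists y, (- y); split; first by rewrite -subr_eq0 opprK -mulr2n -mulr_natr mulf_neq0.
    by apply/setP => w; rewrite !inE eqf_sqr.
  by move=> /eqP.
have le1 (y : k) : (1 + qchar q y - (#|[set w : k | w ^+ 2 == y]|)%:Z : int) >= 0.
  have [s0|[w]] := set_0Vmem [set w : k | w ^+ 2 == y].
    by rewrite s0 cards0; case: (qchar_vals q y) => ->.
  rewrite inE => /eqP <-; have [->|w0] := eqVneq w 0.
    by rewrite expr0n /= sq0 qchar0.
  by rewrite sq2 // qcharX ?expf_card // qchar_sqr.
have sum0 : \sum_(y : k) (1 + qchar q y - (#|[set w : k | w ^+ 2 == y]|)%:Z : int) = 0.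
  rewrite sumrB big_split /= sum_qchar addr0 sumr_const cardT -cardE.
  rewrite (eq_bigr (fun y => \sum_(w : k | w ^+ 2 == y) (1 : int))); last first.
    by move=> y _; rewrite sumr_const cardsE natz.
  rewrite (exchange_big_dep xpredT) //= (eq_bigr (fun _ => 1)).
    by rewrite sumr_const cardT -cardE subrr.
  by move=> w _; rewrite (eq_bigl (pred1 (w ^+ 2))) ?big_pred1_eq // => y; rewrite eq_sym.
have /eqP := sum0; rewrite psumr_eq0 // => /allP/(_ z (mem_index_enum z)) /=.
by rewrite subr_eq0 => /eqP.
Qed.

End FiniteQuadraticCharacter.

(** * Polynomials in a matrix and its eigenvalues *)

Section MatrixPolynomials.

Variables (R : comNzRingType) (n : nat) (A : 'M[R]_n.+1).

Lemma horner_char_poly z : (char_poly A).[z] = \det (z%:M - A).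
Proof.
rewrite -[LHS]/(horner_eval z _) -det_map_mx; congr (\det _).
by apply/matrixP => i j; rewrite !mxE /= /horner_eval !hornerE hornerMn hornerX.
Qed.

Lemma det_horner_mx_prod_XsubC (rs : seq R) :
  \det (horner_mx A (\prod_(z <- rs) ('X - z%:P)))
  = (-1) ^+ (n.+1 * size rs) * \prod_(z <- rs) (char_poly A).[z].
Proof.
elim: rs => [|z rs IHrs]; first by rewrite !big_nil rmorph1 det1 muln0 mulr1.
rewrite !big_cons rmorphM /= det_mulmx IHrs mulnS exprD.
rewrite rmorphB /= horner_mx_X horner_mx_C -opprB -scaleN1r detZ -horner_char_poly.
ring.
Qed.

End MatrixPolynomials.

Section Spectrum.

Variables (K : closedFieldType) (n : nat) (A : 'M[K]_n.+1) (ls : seq K).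
Hypothesis char_polyA : char_poly A = \prod_(l <- ls) ('X - l%:P).

Lemma size_spectrum : size ls = n.+1.
Proof.
by have /eqP := size_char_poly A; rewrite char_polyA size_prod_XsubC eqSS => /eqP.
Qed.

(** Both sides are the resultant of [h] and the characteristic polynomial: factor [h], evaluate the
    characteristic polynomial at its roots, and exchange the two products. The signs cancel. *)
Lemma det_horner_mx_spectrum h : \det (horner_mx A h) = \prod_(l <- ls) h.[l].
Proof.
have [rs ->] := closed_field_poly_normal h; set c := lead_coef h.
rewrite linearZ /= detZ det_horner_mx_prod_XsubC char_polyA.
under [RHS]eq_bigr do rewrite hornerZ.
rewrite big_split /= big_const_seq count_predT iter_mulr_1 size_spectrum; congr (_ * _).
under eq_bigr do rewrite horner_prod.
under [RHS]eq_bigr do rewrite horner_prod.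
rewrite [RHS]exchange_big /= -size_spectrum.
elim: rs => [|z rs IHrs]; first by rewrite muln0 !big_nil mulr1.
rewrite !big_cons -IHrs mulnS exprD.
have -> : \prod_(l <- ls) ('X - z%:P).[l] = (-1) ^+ size ls * \prod_(l <- ls) ('X - l%:P).[z].
  elim: ls => [|l ls' IH]; first by rewrite !big_nil mulr1.
  by rewrite !big_cons IH /= exprS !hornerXsubC; ring.
by rewrite !mulrA; congr (_ * _); rewrite -!mulrA; congr (_ * _); rewrite mulrC.
Qed.

(** Since [y - A^m] is the polynomial [y - X^m] evaluated at [A], the preceding lemma gives the
    characteristic polynomial of [A^m] at every [y], hence as a polynomial over an infinite field;
    the trace is one of its coefficients. *)
Lemma mxtrace_exp_spectrum m : \tr (A ^+ m) = \sum_(l <- ls) l ^+ m.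
Proof.
have ApolyE : char_poly (A ^+ m) = \prod_(l <- ls) ('X - (l ^+ m)%:P).
  apply/eqP; rewrite -subr_eq0; apply/negPn/negP => /closed_nonrootP[y].
  rewrite /root hornerD hornerN subr_eq0 horner_char_poly => /negP; apply.
  have -> : y%:M - A ^+ m = horner_mx A (y%:P - 'X^m).
    by rewrite rmorphB /= horner_mx_C rmorphXn /= horner_mx_X.
  rewrite det_horner_mx_spectrum horner_prod; apply/eqP/eq_bigr => l _.
  by rewrite !hornerE.
have := char_poly_trace (A ^+ m) (ltn0Sn n).
rewrite ApolyE -(big_map (fun l => l ^+ m) xpredT (fun z => 'X - z%:P)).
have size_m : size [seq l ^+ m | l <- ls] = n.+1 by rewrite size_map size_spectrum.
rewrite -[X in _`_X](congr1 predn size_m) coefPn_prod_XsubC ?size_m //.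
by move/oppr_inj; rewrite big_map.
Qed.

Lemma det_spectrum : \det A = \prod_(l <- ls) l.
Proof.
rewrite -{1}(horner_mx_X A) det_horner_mx_spectrum.
by apply: eq_bigr => l _; rewrite hornerX.
Qed.

End Spectrum.

(** * Newton's identities *)

Lemma coef0_prod_1subX (R : comNzRingType) (bs : seq R) :
  (\prod_(b <- bs) (1 - b *: 'X))`_0 = 1.
Proof.
rewrite -horner_coef0 horner_prod big1 // => b _.
by rewrite hornerD hornerN hornerZ hornerX mulr0 subr0 hornerC.
Qed.

Lemma coef_prod_1subX (R : comNzRingType) (ls : seq R) :
  (\prod_(l <- ls) (1 - l *: 'X))`_(size ls) = (-1) ^+ size ls * \prod_(l <- ls) l.
Proof.
have szle (l : R) : (size (1 - l *: 'X)%R <= 2)%N.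
  rewrite (leq_trans (size_polyD _ _)) // geq_max size_poly1 size_polyN.
  by rewrite (leq_trans (size_scale_leq _ _)) // size_polyX.
have szp (s : seq R) : (size (\prod_(l <- s) (1 - l *: 'X))%R <= (size s).+1)%N.
  elim: s => [|l s IHs]; first by rewrite big_nil size_poly1.
  rewrite big_cons (leq_trans (size_mul_leq _ _)) //=.
  by rewrite -subn1 leq_subLR (leq_trans (leq_add (szle l) IHs)).
elim: ls => [|l ls IHls]; first by rewrite !big_nil coef1 mulr1.
rewrite !big_cons mulrBl mul1r -scalerAl coefB coefZ coefXM /= IHls exprS.
by rewrite nth_default ?szp //; ring.
Qed.

(* Newton's identities, relating the power sums [p] of the reciprocal roots of a
   polynomial with constant term 1 to its coefficients [c]. *)
Definition newton_rec (R : nzRingType) (p c : nat -> R) :=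
  forall m, m.+1%:R * c m.+1 = - \sum_(k < m.+1) p k.+1 * c (m - k)%N.

Section Newton.

Variable R : comNzRingType.
Implicit Types (p c : nat -> R) (bs : seq R).

Lemma newton_prod bs :
  newton_rec (fun k => \sum_(b <- bs) b ^+ k) (fun i => (\prod_(b <- bs) (1 - b *: 'X))`_i).
Proof.
elim: bs => [|b bs IHbs] m.
  by rewrite big_nil coef1 mulr0 big1 ?oppr0 // => k _; rewrite big_nil mul0r.
set P := \prod_(b <- bs) _ in IHbs; rewrite big_cons -/P.
set P' := (1 - b *: 'X) * P.
have coefP' i : P'`_i = P`_i - b * (if i is j.+1 then P`_j else 0).
  rewrite /P' mulrBl mul1r coefB -scalerAl coefZ coefXM; by case: i.
(* The contribution of the new factor: multiplying [(1 - b X) P] by the geometric series of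
   [b X / (1 - b X)] leaves [b X P]. *)
have geo i : \sum_(k < i.+1) b ^+ k.+1 * P'`_(i - k) = b * P`_i.
  elim: i => [|i IHi].
    by rewrite big_ord1 coefP' mulr0 subr0.
  rewrite big_ord_recl /= subn0 coefP' expr1.
  under eq_bigr do rewrite /bump /= add1n subSS exprS -mulrA.
  by rewrite -mulr_sumr IHi; ring.
under eq_bigr do rewrite big_cons mulrDl.
rewrite big_split /= geo coefP'.
pose s k := \sum_(b <- bs) b ^+ k.
have -> : \sum_(k < m.+1) (\sum_(b <- bs) b ^+ k.+1) * P'`_(m - k)
    = \sum_(k < m.+1) s k.+1 * P`_(m - k) - b * \sum_(k < m) s k.+1 * P`_(m.-1 - k).
  under eq_bigr do rewrite -/(s _) coefP' mulrBr.
  rewrite sumrB; congr (_ - _).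
  rewrite big_ord_recr /= subnn mulr0 mulr0 addr0 mulr_sumr.
  apply: eq_bigr => k _; rewrite mulrCA; congr (_ * (_ * _)).
  by have -> : (m - k = (m.-1 - k).+1)%N by have := ltn_ord k; lia.
rewrite -[\sum_(k < m.+1) s _ * _]opprK -IHbs.
have -> : b * \sum_(k < m) s k.+1 * P`_(m.-1 - k) = - b * (m%:R * P`_m).
  case: m => [|m]; first by rewrite big_ord0 mul0r !mulr0.
  by rewrite IHbs mulrN mulNr opprK.
by rewrite -[in LHS]natr1; ring.
Qed.

(** Used over the integers to show that the L-polynomial is unique, and in characteristic [p] up to
    index [g < p]. *)
Lemma newton_rec_coef p c c' N :
  (forall m, (0 < m <= N)%N -> GRing.lreg (m%:R : R)) -> c 0%N = c' 0%N ->
  newton_rec p c -> newton_rec p c' -> forall i, (i <= N)%N -> c i = c' i.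
Proof.
move=> reg c0 cP c'P i; elim/ltn_ind: i => -[//|i] IHi leN.
apply: (reg i.+1); rewrite ?leN // cP c'P; congr (- _); apply: eq_bigr => k _.
by rewrite IHi //; have := ltn_ord k; lia.
Qed.

(** In this direction the identities are triangular with diagonal entry [c 0 = 1], so the power sums
    are determined over any ring. *)
Lemma newton_rec_power p p' c : c 0%N = 1 ->
  newton_rec p c -> newton_rec p' c -> forall k, p k.+1 = p' k.+1.
Proof.
move=> c0 cP cP'; elim/ltn_ind => k IHk.
have := cP k; rewrite cP' => /oppr_inj; rewrite !big_ord_recr /= subnn c0 !mulr1.
rewrite (eq_bigr (fun i : 'I_k => p i.+1 * c (k - i)%N)); last by move=> i _; rewrite IHk.
by move=> /addrI.
Qed.

End Newton.

(** * Frobenius orbits *)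

Section Frobenius.

Variables (k : finFieldType) (K : closedFieldType) (emb : {rmorphism k -> K}).
Local Notation q := #|k|.
Local Notation "h ^e" := (map_poly emb h) (at level 2, format "h ^e").

Let q_gt1 : (1 < q)%N := finNzRing_gt1 k.

Lemma frobD m : {morph (fun x : K => x ^+ (q ^ m)) : x y / x + y}.
Proof.
have [p p_pr pk] := finPcharP k.
have pK : p \in [pchar K] by rewrite (fmorph_pchar emb).
move=> x y; apply: (@exprDn_pchar _ x y _).
rewrite (card_pprimeChar pk : q = _) -expnM pnatX; apply/orP; left.
by rewrite pnatE // p_pr.
Qed.

Fact frob_zmod m : zmod_morphism (fun x : K => x ^+ (q ^ m)).
Proof.
move=> x y; have := frobD m (x - y) y; rewrite subrK => ->.
by rewrite addrK.
Qed.

Fact frob_monoid m : monoid_morphism (fun x : K => x ^+ (q ^ m)).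
Proof. by split=> [|x y]; rewrite ?expr1n ?exprMn. Qed.

Definition frob m (x : K) := x ^+ (q ^ m).
HB.instance Definition _ m := GRing.isZmodMorphism.Build K K (frob m) (frob_zmod m).
HB.instance Definition _ m := GRing.isMonoidMorphism.Build K K (frob m) (frob_monoid m).

Lemma frob0 x : frob 0 x = x. Proof. by rewrite /frob expr1. Qed.

Lemma frob_comp m n x : frob m (frob n x) = frob (m + n) x.
Proof. by rewrite /frob -exprM -expnD addnC. Qed.

Lemma frob_inj m x y : frob m x = frob m y -> x = y. Proof. exact: fmorph_inj. Qed.

Lemma frob_mul m n x : frob m x = x -> frob (n * m) x = x.
Proof.
by move=> xm; elim: n => [|n IHn]; rewrite ?frob0 // mulSn -frob_comp IHn.
Qed.

Lemma frob_base m a : frob m (emb a) = emb a.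
Proof.
rewrite -[m]muln1; apply: frob_mul.
by rewrite /frob expn1 -rmorphXn /= expf_card.
Qed.

Lemma frob1_base x : frob 1 x = x -> exists a, x = emb a.
Proof.
move=> fx; have : root (map_poly emb ('X^q - 'X)) x.
  by rewrite rmorphB /= map_polyXn map_polyX /root !hornerE -[q]expn1 -/(frob 1 x) fx subrr.
rewrite finField_genPoly rmorph_prod (eq_bigr (fun a => 'X - (emb a)%:P)).
  rewrite -(big_map emb xpredT (fun a => 'X - a%:P)).
  by rewrite root_prod_XsubC => /mapP[a _ ->]; exists a.
by move=> a _; rewrite rmorphB /= map_polyX map_polyC.
Qed.

Lemma frob_poly_base (g : {poly K}) :
  map_poly (frob 1) g = g -> exists h, g = h^e.
Proof.
move=> fg; pose c i := odflt 0 [pick a | emb a == g`_i].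
exists (\poly_(i < size g) c i); apply/polyP => i; rewrite coef_map coef_poly.
case: ltnP => [lt_i|le_i]; last first.
  by rewrite nth_default //; exact/esym/rmorph0.
have [a ga] : exists a, g`_i = emb a by apply: frob1_base; rewrite -[in RHS]fg coef_map.
by rewrite /c; case: pickP => /= [b /eqP -> //| /(_ a)]; rewrite ga eqxx.
Qed.

Lemma horner_frob (h : {poly k}) m x : h^e.[frob m x] = frob m h^e.[x].
Proof.
rewrite -horner_map; congr (_.[_]); rewrite -map_poly_comp.
by apply: eq_map_poly => a /=; rewrite frob_base.
Qed.

Lemma root_frob (h : {poly k}) m x : root h^e (frob m x) = root h^e x.
Proof. by rewrite /root horner_frob fmorph_eq0. Qed.

(** The degree of [x] over [k]. In contrast, [orbit_poly x m] is used for every [m] fixing [x]: it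
    is the characteristic polynomial of [x] over [k] in the field with [q^m] elements, a power of
    the minimal polynomial. *)
Definition period x m :=
  [/\ (0 < m)%N, frob m x = x & forall i, (0 < i < m)%N -> frob i x != x].

Definition frob_orbit x m := [seq frob i x | i <- iota 0 m].

Definition orbit_poly x m : {poly K} := \prod_(z <- frob_orbit x m) ('X - z%:P).

Lemma orbit_polyE x m : orbit_poly x m = \prod_(i < m) ('X - (frob i x)%:P).
Proof. by rewrite /orbit_poly big_map -[in iota 0 m](subn0 m) big_mkord. Qed.

Lemma size_orbit_poly x m : size (orbit_poly x m) = m.+1.
Proof. by rewrite size_prod_XsubC size_map size_iota. Qed.

Lemma monic_orbit_poly x m : orbit_poly x m \is monic.
Proof. exact: monic_prod_XsubC. Qed.

Lemma orbit_poly_base x m : frob m x = x ->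
  exists h : {poly k}, [/\ h \is monic, size h = m.+1 & h^e = orbit_poly x m].
Proof.
move=> xm; have [|h hE] := @frob_poly_base (orbit_poly x m).
  rewrite orbit_polyE rmorph_prod /= (eq_bigr (fun i : 'I_m => 'X - (frob i.+1 x)%:P)).
    case: m xm => [|m] xm; first by rewrite !big_ord0.
    by rewrite big_ord_recr big_ord_recl /= xm frob0 mulrC.
  by move=> i _; rewrite map_polyXsubC /= frob_comp add1n.
exists h; split=> //.
- by rewrite -(map_monic emb) -hE monic_orbit_poly.
- by rewrite -(size_map_poly emb) -hE size_orbit_poly.
Qed.

Lemma period_uniq x m : period x m -> uniq (frob_orbit x m).
Proof.
case=> m_gt0 xm min_m; rewrite map_inj_in_uniq ?iota_uniq // => i j.
rewrite !mem_iota /= !add0n => im jm.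
wlog le_ij : i j im jm / (i <= j)%N => [WL e|e].
  by case: (leqP i j) => [/WL|/ltnW/WL]; [apply | move=> E; apply/esym/E].
have /eqP : frob (j - i) x = x by apply: (@frob_inj i); rewrite frob_comp subnKC.
case: (posnP (j - i)) => [|ji]; first by move: le_ij; lia.
by rewrite (negPf (min_m _ _)) // ji; move: jm; lia.
Qed.

Lemma period_dvdn x m n : period x m -> (frob n x == x) = (m %| n)%N.
Proof.
case=> m_gt0 xm min_m; rewrite {1}(divn_eq n m) addnC -frob_comp frob_mul //.
rewrite /dvdn; case: (posnP (n %% m)) => [->|r_gt0]; first by rewrite frob0 eqxx.
by rewrite (negPf (min_m _ _)) // r_gt0 ltn_mod.
Qed.

Lemma exists_period (h : {poly k}) x : h != 0 -> root h^e x ->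
  exists2 m, (m < size h)%N & period x m.
Proof.
move=> h0 hx; have exm : exists m, [&& (0 < m)%N, (m < size h)%N & frob m x == x].
  pose rs := frob_orbit x (size h).
  have rs_h : all (root h^e) rs by apply/allP => _ /mapP[i _ ->]; rewrite root_frob.
  have he0 : h^e != 0 by rewrite map_poly_eq0.
  have : ~~ uniq rs.
    apply/negP => /(max_poly_roots he0 rs_h).
    by rewrite size_map_poly size_map size_iota ltnn.
  move=> /(uniqPn 0).
  case=> i [j [ij]]; rewrite size_map size_iota => j_h.
  rewrite !(nth_map 0%N) ?size_iota ?nth_iota ?(ltn_trans ij) // !add0n => e.
  exists (j - i)%N; rewrite subn_gt0 ij (leq_ltn_trans (leq_subr _ _)) //=.
  by apply/eqP; apply: (@frob_inj i); rewrite frob_comp subnKC // ltnW.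
case: (ex_minnP exm) => m /and3P[m0 mh /eqP xm] min_m; exists m => //; split=> // i /andP[i0 im].
apply/negP => xi; have := min_m i; rewrite i0 xi (ltn_trans im mh) /= => /(_ isT).
by rewrite leqNgt im.
Qed.

Lemma frob_minpoly x m : period x m -> exists P : {poly k},
  [/\ P \is monic, size P = m.+1, P^e = orbit_poly x m
    & forall h : {poly k}, (P %| h) = root h^e x].
Proof.
move=> xm; have [_ fx _] := xm; have [P [Pmon szP PE]] := orbit_poly_base fx.
exists P; split=> // h; rewrite -(dvdp_map emb) PE.
apply/idP/idP => [|hx].
  move=> /dvdpP[g ->]; rewrite rootM /orbit_poly root_prod_XsubC; apply/orP; right.
  by apply/mapP; exists 0%N; rewrite ?frob0 // mem_iota /=; case: xm.
apply: uniq_roots_dvdp; last by rewrite uniq_rootsE period_uniq.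
by apply/allP => _ /mapP[i _ ->]; rewrite root_frob.
Qed.

Hypothesis k2 : (2 : k) != 0.

(** The norm has exponent [1 + q + ... + q^(m-1)], and this number times [(q-1)/2] is
    [(q^m-1)/2]. *)
Lemma qchar_frob_norm x m : (0 < m)%N ->
  qchar q (\prod_(i < m) frob i x) = qchar (q ^ m) x.
Proof.
move=> m0; have q_odd := odd_card_finField k2.
rewrite /qchar /frob -expr_sum expf_eq0.
have expE : ((\sum_(i < m) q ^ i) * q.-1./2 = (q ^ m).-1./2)%N.
  rewrite predn_exp; move: (half_pred_odd q_odd).
  by set h := q.-1./2; move=> <-; rewrite -doubleMl doubleK mulnC.
rewrite -exprM expE.
have -> // : (0 < \sum_(i < m) q ^ i)%N.
by case: m m0 {expE} => // m _; rewrite big_ord_recl expn0.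
Qed.

End Frobenius.

(** * The functional equation *)

Section ResidueCharacter.

Variables (k : finFieldType) (d1 : nat) (C : 'M[k]_d1.+1).
Hypothesis k2 : (2 : k) != 0.
Local Notation q := #|k|.
Local Notation d := d1.+1.
Local Notation f := (char_poly C).

(* The determinant is the resultant of [f] and [h], so for [h] monic and irreducible
   this is, up to a sign depending on [size h], the Legendre symbol of [f] modulo [h].
   It only depends on [h %% f], which replaces quadratic reciprocity. *)
Definition rchar (h : {poly k}) : int := qchar q (\det (horner_mx C h)).

Let q_gt1 : (1 < q)%N := finNzRing_gt1 k.
Let q_odd : odd q := odd_card_finField k2.

Lemma rcharM g h : rchar (g * h) = rchar g * rchar h.
Proof. by rewrite /rchar rmorphM det_mulmx qcharM ?expf_card. Qed.

Lemma rchar_mod h : rchar (h %% f) = rchar h.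
Proof.
congr (qchar _ (\det _)); rewrite [in RHS](divp_eq h f) rmorphD rmorphM /=.
by rewrite Cayley_Hamilton mulr0 add0r.
Qed.

Lemma rcharC c : rchar c%:P = qchar q c ^+ d.
Proof. by rewrite /rchar horner_mx_C det_scalar qcharX ?expf_card. Qed.

Lemma rchar0 : rchar 0 = 0.
Proof. by rewrite rcharC qchar0 expr0n. Qed.

Lemma rchar1 : rchar 1 = 1.
Proof. by rewrite rcharC qchar1 expr1n. Qed.

Lemma rcharZ c h : rchar (c *: h) = qchar q c ^+ d * rchar h.
Proof. by rewrite -mul_polyC rcharM rcharC. Qed.

Lemma rchar_prod_XsubC (K : closedFieldType) (emb : {rmorphism k -> K}) h ls :
  map_poly emb f = \prod_(l <- ls) ('X - l%:P) ->
  rchar h = qchar q (\prod_(l <- ls) (map_poly emb h).[l]).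
Proof.
rewrite map_char_poly => fE.
by rewrite /rchar -(qchar_rmorph emb) -det_map_mx map_horner_mx (det_horner_mx_spectrum fE).
Qed.

Lemma rchar_coprime h : coprimep f h -> rchar h ^+ 2 = 1.
Proof.
move=> /Bezout_eq1_coprimepP[[a b] /= ab]; apply: qchar_sqr.
apply/eqP => Nh0; have := congr1 (fun h => \det (horner_mx C h)) ab.
rewrite rmorphD !rmorphM /= Cayley_Hamilton mulr0 add0r det_mulmx Nh0 mulr0 rmorph1 det1.
by move/eqP; rewrite eq_sym oner_eq0.
Qed.

Lemma rchar_eq0 h : ~~ coprimep f h -> rchar h = 0.
Proof.
move=> fh; have [K [emb _]] := countable_algebraic_closure k.
have [x] : exists x, root (map_poly emb (gcdp f h)) x.
  by apply/closed_rootP; rewrite size_map_poly.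
rewrite gcdp_map root_gcd => /andP[fx hx].
have [ls fE] := closed_field_poly_normal (map_poly emb f).
rewrite (monicP _) ?map_monic ?char_poly_monic // scale1r in fE.
apply/eqP; rewrite (rchar_prod_XsubC _ fE) qchar_eq0 prodf_seq_eq0; apply/hasP.
by exists x => //; rewrite -root_prod_XsubC -fE.
Qed.

Hypothesis f_sep : separable_poly f.

(** Primitivity of the character. If a prime factor [P] of [f] divides [u], the Chinese remainder
    theorem gives [v] congruent to 1 modulo [f / P] and to a nonsquare modulo [P]; then [u v] and
    [u] agree modulo [f]. The case [u = 0] says that the character is nontrivial. *)
Lemma rchar_twist u : ~~ coprimep f u ->
  exists v, [/\ coprimep f v, rchar v = -1 & f %| u * (v - 1)].
Proof.
move=> fu; have [K [emb _]] := countable_algebraic_closure k.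
have [x] : exists x, root (map_poly emb (gcdp f u)) x.
  by apply/closed_rootP; rewrite size_map_poly.
rewrite gcdp_map root_gcd => /andP[fx ux].
have f0 : f != 0 by rewrite monic_neq0 ?char_poly_monic.
have [m _ xm] := exists_period f0 fx; have [m0 _ _] := xm.
have [P [Pmon szP PE Pdvd]] := frob_minpoly emb xm.
have [f' fE] : exists f', f = P * f'.
  by have /dvdpP[f' ->] : P %| f; [rewrite Pdvd | exists f'; rewrite mulrC].
have Pf' : coprimep P f' by apply: (separable_coprime f_sep); rewrite fE.
(* The polynomials of degree less than [m] take [q^m] distinct values at [x]. Were none of them a
   nonsquare, all would be roots of [X (X^((Q-1)/2) - 1)], whose degree is less than [Q = q^m]. *)
have [w wx] : exists w : {poly k}, qchar (q ^ m) (map_poly emb w).[x] = -1.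
  pose Q := (q ^ m)%N.
  have Q_gt1 : (1 < Q)%N by rewrite -(expn0 q) ltn_exp2l.
  have Q_odd : odd Q by rewrite oddX q_odd orbT.
  have [w|all1] := pickP (fun w : 'rV[k]_m => qchar Q (map_poly emb (rVpoly w)).[x] == -1).
    by move=> /eqP ?; exists (rVpoly w).
  pose vals := [seq (map_poly emb (rVpoly w)).[x] | w : 'rV[k]_m].
  have vals_uniq : uniq vals.
    rewrite map_inj_uniq ?enum_uniq // => w w' ww'; apply: (can_inj rVpolyK).
    apply/eqP; rewrite -subr_eq0; apply: contraTT isT => ww0.
    have : P %| rVpoly w - rVpoly w' by rewrite Pdvd rmorphB /root hornerD hornerN ww' subrr.
    move=> /(dvdp_leq ww0); rewrite szP leqNgt ltnS (leq_trans (size_polyD _ _)) //.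
    by rewrite geq_max size_polyN !size_poly.
  have size_vals : size vals = Q by rewrite size_map -cardE card_mx mul1n.
  pose g : {poly K} := 'X * ('X^(Q.-1./2) - 1).
  have h0 := half_pred_gt0 Q_gt1 Q_odd.
  have szg : size g = (Q.-1./2).+2 by rewrite /g mulrC size_mulX ?size_XnsubC // -size_poly_gt0 size_XnsubC.
  have g0 : g != 0 by rewrite -size_poly_gt0 szg.
  suff /max_poly_roots : all (root g) vals.
    move/(_ g0 vals_uniq); rewrite size_vals szg ltnS => le_Q.
    have := half_pred_odd Q_odd; clear -le_Q h0 Q_gt1; move: le_Q h0 Q_gt1.
    by move: (Q.-1./2) => h; move: Q => Q; lia.
  apply/allP => _ /mapP[w _ ->]; rewrite rootM rootX /root !hornerE subr_eq0.
  by have := all1 w; rewrite /qchar; case: ifP => //= _; case: ifP.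
have /Bezout_eq1_coprimepP[[a b] /= ab] := Pf'.
have e : b * f' = 1 - a * P by rewrite -ab addrC addKr.
have v1 : b * f' * w + a * P - 1 = b * f' * (w - 1) by rewrite e; ring.
have vw : b * f' * w + a * P - w = a * P * (1 - w) by rewrite e; ring.
exists (b * f' * w + a * P); set v := b * f' * w + a * P in v1 vw *.
have chiv : rchar v = -1.
  have [rs f'E] := closed_field_poly_normal (map_poly emb f').
  have f'mon : map_poly emb f' \is monic.
    by rewrite map_monic -(monicMl _ Pmon) -fE char_poly_monic.
  rewrite (monicP f'mon) scale1r in f'E.
  rewrite (@rchar_prod_XsubC _ emb _ (frob_orbit k x m ++ rs)); last first.
    by rewrite fE rmorphM /= PE f'E big_cat.
  rewrite big_cat /= [X in _ * X]big1_seq => [|r /= r_rs]; last first.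
    have : root (map_poly emb (v - 1)) r.
      by rewrite v1 !rmorphM !rootM /= f'E root_prod_XsubC r_rs orbT.
    by rewrite rmorphB rmorph1 /root !hornerE subr_eq0 => /eqP.
  rewrite mulr1 big_map -[in iota 0 m](subn0 m) big_mkord -wx -(qchar_frob_norm k2 _ m0).
  congr (qchar _ _); apply: eq_bigr => i _; rewrite -(horner_frob emb).
  have : root (map_poly emb (v - w)) (frob k i x).
    rewrite root_frob vw !rmorphM !rootM /= PE.
    apply/orP; left; apply/orP; right; rewrite root_prod_XsubC; apply/mapP; exists 0%N; rewrite ?frob0 //.
    by rewrite mem_iota.
  by rewrite rmorphB /root hornerD hornerN subr_eq0 => /eqP.
split=> //.
- by apply: contraTT isT => /rchar_eq0; rewrite chiv.
have -> : u * (v - 1) = b * (w - 1) * (u * f') by rewrite v1; ring.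
by rewrite fE dvdp_mull // dvdp_mul // Pdvd.
Qed.

Local Notation chi := rchar.

(** Row vectors of length [n] stand for the polynomials of degree less than [n]; here the leading
    coefficient is split off. *)
Lemma sum_polyC_X n (F : {poly k} -> int) :
  \sum_(h : 'rV[k]_n.+1) F (rVpoly h)
  = \sum_(c : k) \sum_(w : 'rV[k]_n) F (c *: 'X^n + rVpoly w).
Proof.
rewrite pair_big /=.
pose to_h (cw : k * 'rV[k]_n) : 'rV[k]_n.+1 := poly_rV (cw.1 *: 'X^n + rVpoly cw.2).
pose of_h (h : 'rV[k]_n.+1) : k * 'rV[k]_n := ((rVpoly h)`_n, poly_rV (take_poly n (rVpoly h))).
have szto c (w : 'rV[k]_n) : (size (c *: 'X^n + rVpoly w)%R <= n.+1)%N.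
  rewrite (leq_trans (size_polyD _ _)) // geq_max (leq_trans (size_scale_leq _ _)) ?size_polyXn //=.
  by rewrite (leq_trans (size_poly _ _)).
rewrite (reindex to_h) /=; last first.
  exists of_h => [[c w] _ | h _]; rewrite /to_h /of_h /=.
    rewrite poly_rV_K // coefD coefZ coefXn eqxx mulr1 (nth_default _ (size_poly _ _)) addr0.
    congr (_, _); rewrite take_polyD take_polyZ /=.
    rewrite -[w in RHS]rVpolyK; congr poly_rV.
    rewrite (take_poly_id (size_poly _ _)).
    by rewrite -['X^n]mul1r take_polyMXn_0 // scaler0 add0r.
  rewrite poly_rV_K ?size_take_poly // -[h in RHS]rVpolyK; congr poly_rV.
  rewrite addrC -[in RHS](poly_take_drop n (rVpoly h)) -mul_polyC; congr (_ + _ * _).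
  apply/polyP => i; rewrite coefC coef_drop_poly; case: i => [|i] /=; first by rewrite add0n.
  by rewrite nth_default // (leq_trans (size_poly _ _)) // addSn ltnS leq_addl.
by apply: eq_bigr => -[c w] _; rewrite /to_h poly_rV_K.
Qed.

Lemma sum_scale n (F : {poly k} -> int) c : c != 0 ->
  \sum_(w : 'rV[k]_n) F (c *: 'X^n + rVpoly w)
  = \sum_(w : 'rV[k]_n) F (c *: ('X^n + rVpoly w)).
Proof.
move=> c0; rewrite (reindex_inj (scalerI c0)) /=.
by apply: eq_bigr => w _; rewrite linearZ scalerDr.
Qed.

Definition monic_sum n : int := \sum_(w : 'rV[k]_n) chi ('X^n + rVpoly w).
Definition all_sum n : int := \sum_(h : 'rV[k]_n) chi (rVpoly h).

Lemma monic_sum0 : monic_sum 0 = 1.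
Proof.
rewrite /monic_sum (big_pred1 0) => [|w]; first by rewrite linear0 addr0 expr0 rchar1.
by rewrite /= !thinmx0 eqxx.
Qed.

Lemma all_sum0 : all_sum 0 = 0.
Proof.
rewrite /all_sum (big_pred1 0) => [|w]; first by rewrite linear0 rchar0.
by rewrite /= !thinmx0 eqxx.
Qed.

Lemma all_sumS n :
  all_sum n.+1 = all_sum n + (\sum_(c : k | c != 0) qchar q c ^+ d) * monic_sum n.
Proof.
rewrite /all_sum sum_polyC_X (bigD1 0) //=; congr (_ + _).
  by apply: eq_bigr => w _; rewrite scale0r add0r.
rewrite mulr_suml; apply: eq_bigr => c c0; rewrite sum_scale // mulr_sumr.
by apply: eq_bigr => w _; rewrite rcharZ.
Qed.

(* [lam] is the residue functional: the pairing [lam (u * h)] on [k[x]/f] is perfect. *)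
Definition lam (h : {poly k}) : k := (h %% f)`_d1.

Lemma lamD g h : lam (g + h) = lam g + lam h.
Proof. by rewrite /lam modpD coefD. Qed.

Lemma lamB g h : lam (g - h) = lam g - lam h.
Proof. by rewrite /lam modpD modpN coefB. Qed.

Lemma lamZ c h : lam (c *: h) = c * lam h.
Proof. by rewrite /lam modpZl coefZ. Qed.

Lemma lam_mod g h : lam (g * (h %% f)) = lam (g * h).
Proof. by rewrite /lam modp_mul. Qed.

Let f0 : f != 0. Proof. by rewrite monic_neq0 ?char_poly_monic. Qed.

Lemma lam_small (h : {poly k}) : (size h <= d)%N -> lam h = h`_d1.
Proof. by move=> h_d; rewrite /lam modp_small // size_char_poly ltnS. Qed.

Lemma sum_mulmod v (F : {poly k} -> int) : coprimep f v ->
  \sum_(h : 'rV[k]_d) F (rVpoly h) = \sum_(h : 'rV[k]_d) F ((v * rVpoly h) %% f).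
Proof.
move=> fv; have sz_mod g : (size (g %% f)%R <= d)%N.
  by rewrite -ltnS -(size_char_poly C) ltn_modp.
rewrite (reindex_inj (h := fun h : 'rV[k]_d => poly_rV ((v * rVpoly h) %% f))) /=.
  by apply: eq_bigr => h _; rewrite poly_rV_K.
move=> h h' /(congr1 rVpoly); rewrite !poly_rV_K // => /eqP; rewrite -subr_eq0.
rewrite -modpN -modpD -mulrBr => /eqP/modp_eq0P; rewrite Gauss_dvdpr // => fh.
apply: (can_inj rVpolyK); apply/eqP; rewrite -subr_eq0; apply: contraTT isT => hh0.
have := dvdp_leq hh0 fh; rewrite leqNgt size_char_poly ltnS (leq_trans (size_polyD _ _)) //.
by rewrite geq_max size_polyN !size_poly.
Qed.

Lemma all_sum_d : all_sum d = 0.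
Proof.
have f_0 : ~~ coprimep f 0.
  by rewrite coprimep0 -size_poly_eq1 size_char_poly.
have [v [fv chiv _]] := rchar_twist f_0.
suff : all_sum d = - all_sum d by lia.
rewrite {1}/all_sum (sum_mulmod chi fv) -mulN1r mulr_sumr.
by apply: eq_bigr => h _; rewrite rchar_mod rcharM chiv.
Qed.

Lemma sum_translate_d (a : {poly k}) : \sum_(z : 'rV[k]_d) chi (a + rVpoly z) = 0.
Proof.
have sz_mod : (size (a %% f)%R <= d)%N by rewrite -ltnS -(size_char_poly C) ltn_modp.
rewrite -[RHS]all_sum_d [RHS](reindex_inj (addrI (poly_rV (a %% f)))) /=.
apply: eq_bigr => z _; rewrite linearD /= poly_rV_K // -[LHS]rchar_mod modpD.
by rewrite [rVpoly z %% f]modp_small // size_char_poly ltnS size_poly.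
Qed.

Lemma monic_sum_large n : (d <= n)%N -> monic_sum n = 0.
Proof.
move=> d_n; suff : (q ^ d)%:Z * monic_sum n = 0.
  by move/eqP; rewrite mulf_eq0 eqz_nat expn_eq0 => /orP[|/eqP //]; move: q_gt1; case: #|k|.
(* Averages over translations by all [z] of degree less than [d <= n]. Each of them permutes the
   monic polynomials of degree [n], while the sum over [z] runs through a full system of residues
   modulo [f]. *)
transitivity (\sum_(z : 'rV[k]_d) monic_sum n).
  by rewrite sumr_const cardT -cardE card_mx mul1n -mulr_natl natz.
have sz (z : 'rV[k]_d) : (size (rVpoly z) <= n)%N by rewrite (leq_trans (size_poly _ _)).
transitivity (\sum_(z : 'rV[k]_d) \sum_(w : 'rV[k]_n) chi ('X^n + rVpoly w + rVpoly z)).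
  apply: eq_bigr => z _; rewrite /monic_sum (reindex_inj (addIr (poly_rV (rVpoly z)))) /=.
  by apply: eq_bigr => w _; rewrite linearD /= poly_rV_K // addrA.
by rewrite exchange_big big1 //= => w _; rewrite sum_translate_d.
Qed.

(* Averaging an additive character [x |-> psi (c * x)] over [c != 0], with the weight
   [qchar q c ^+ d], gives up to scaling such an integer-valued kernel. *)
Variable kap : k -> int.
Hypothesis sum_kap : \sum_x kap x = 0.

(** A Gauss sum at frequency [u], with [kap] in the role of the additive character. *)
Definition fourier (u : {poly k}) : int :=
  \sum_(h : 'rV[k]_d) chi (rVpoly h) * kap (lam (u * rVpoly h)).

Lemma fourier_mul u v : coprimep f v -> fourier u = chi v * fourier (u * v).
Proof.
move=> fv; rewrite /fourier (sum_mulmod (fun h => chi h * kap (lam (u * h))) fv) mulr_sumr.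
by apply: eq_bigr => h _; rewrite rchar_mod rcharM lam_mod !mulrA.
Qed.

(** For a unit [u] this is a substitution. Otherwise [rchar_twist] gives [v] such that replacing [u]
    by [u v] leaves the sum unchanged and also reverses its sign, so both sides vanish. *)
Lemma fourier_eq u : fourier u = chi u * fourier 1.
Proof.
have [fu|fu] := boolP (coprimep f u).
  by rewrite [fourier 1](fourier_mul _ fu) mul1r mulrA -expr2 rchar_coprime // mul1r.
rewrite rchar_eq0 // mul0r; have [v [fv chiv fuv]] := rchar_twist fu.
have : fourier u = - fourier u; last by lia.
rewrite {1}(fourier_mul _ fv) chiv mulN1r; congr (- _).
apply: eq_bigr => h _; congr (_ * kap _); apply/eqP; rewrite -subr_eq0.
have -> : lam (u * v * rVpoly h) - lam (u * rVpoly h) = lam (u * (v - 1) * rVpoly h).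
  by rewrite -lamB; congr lam; ring.
by rewrite /lam (modp_eq0 (dvdp_mulr _ fuv)) coef0.
Qed.

Lemma sum_kap_affine n (l : 'rV[k]_n -> k) x :
  (forall c w w', l (c *: w + w') = c * l w + l w') -> (exists w, l w != 0) ->
  \sum_(w : 'rV[k]_n) kap (x + l w) = 0.
Proof.
move=> l_lin [w0 lw0]; set S := LHS; suff : q%:Z * S = 0.
  by move/eqP; rewrite mulf_eq0 => /orP[|/eqP //]; move: q_gt1; lia.
have -> : q%:Z * S = \sum_(c : k) \sum_(w : 'rV[k]_n) kap (x + l (c *: w0 + w)).
  transitivity (\sum_(c : k) S); first by rewrite sumr_const cardT -cardE -mulr_natl natz.
  by apply: eq_bigr => c _; rewrite [LHS](reindex_inj (addrI (c *: w0))).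
rewrite exchange_big big1 //= => w _; rewrite -[RHS]sum_kap.
rewrite [RHS](reindex_inj (addIr (x + l w))) /= [RHS](reindex_inj (mulIf lw0)) /=.
by apply: eq_bigr => c _; rewrite l_lin; congr kap; ring.
Qed.

(** For the pairing [lam (w * h)], the annihilator of the polynomials of degree less than [n]
    consists of those of degree less than [d - n]. Off the annihilator the linear form is onto and
    [kap] sums to 0. *)
Lemma sum_kap_orth n a (h : {poly k}) : (n <= d)%N -> (size h <= d)%N ->
  \sum_(w : 'rV[k]_n) kap (lam ((a + rVpoly w) * h))
  = if (size h <= d - n)%N then (q ^ n)%:Z * kap (lam (a * h)) else 0.
Proof.
move=> n_d h_d; have lamE w : lam ((a + rVpoly w) * h) = lam (a * h) + lam (rVpoly w * h).
  by rewrite mulrDl lamD.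
under eq_bigr do rewrite lamE.
case: leqP => [h_small|h_big].
  transitivity (\sum_(w : 'rV[k]_n) kap (lam (a * h))).
    apply: eq_bigr => w _; congr kap; rewrite -[RHS]addr0; congr (_ + _).
    have sz : (size (rVpoly w * h)%R <= d1)%N.
      rewrite (leq_trans (size_mul_leq _ _)) //.
      by rewrite -subn1 leq_subLR add1n -(subnKC n_d) leq_add ?size_poly.
    by rewrite lam_small ?nth_default // (leq_trans sz).
  by rewrite sumr_const cardT -cardE card_mx mul1n -mulr_natl natz.
apply: (sum_kap_affine _ (l := fun w => lam (rVpoly w * h))) => [c w w'|].
  by rewrite linearP /= mulrDl -scalerAl lamD lamZ.
have s0 : (0 < size h)%N by apply: leq_trans h_big.
have lt_n : (d - size h < n)%N by move: h_big h_d n_d s0; lia.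
(* This monomial raises [h] to degree exactly [d - 1], where [lam] reads off the leading
   coefficient. *)
exists (poly_rV 'X^(d - size h)); rewrite poly_rV_K ?size_polyXn //.
have h0 : h != 0 by rewrite -size_poly_gt0.
have szX : size ('X^(d - size h) * h) = d.
  by rewrite mulrC size_mulXn // subnK.
have lcE : ('X^(d - size h) * h)`_d1 = lead_coef ('X^(d - size h) * h).
  by rewrite /lead_coef szX.
by rewrite lam_small ?szX // lcE lead_coef_eq0 mulf_neq0 // monic_neq0 ?monicXn.
Qed.

Lemma sum_small n (F : {poly k} -> int) : (n <= d)%N ->
  \sum_(h : 'rV[k]_d) (if (size (rVpoly h) <= n)%N then F (rVpoly h) else 0)
  = \sum_(h : 'rV[k]_n) F (rVpoly h).
Proof.
move=> n_d; rewrite -big_mkcond /=.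
rewrite (reindex_onto (fun w : 'rV[k]_n => poly_rV (rVpoly w))
                      (fun h : 'rV[k]_d => poly_rV (rVpoly h))) /=; last first.
  by move=> h h_n; rewrite poly_rV_K // rVpolyK.
have sz (w : 'rV[k]_n) : (size (rVpoly w) <= d)%N by rewrite (leq_trans (size_poly _ _)).
apply: eq_big => [w|w _]; last by rewrite poly_rV_K.
by rewrite poly_rV_K // rVpolyK size_poly eqxx.
Qed.

Lemma poisson n a : (n <= d)%N ->
  fourier 1 * \sum_(w : 'rV[k]_n) chi (a + rVpoly w)
  = (q ^ n)%:Z * \sum_(h : 'rV[k]_(d - n)) chi (rVpoly h) * kap (lam (a * rVpoly h)).
Proof.
move=> n_d; rewrite mulr_sumr.
under eq_bigr do rewrite mulrC -fourier_eq.
rewrite exchange_big /=; under eq_bigr do rewrite -mulr_sumr sum_kap_orth ?size_poly //.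
rewrite mulr_sumr -(sum_small (fun h => (q ^ n)%:Z * (chi h * kap (lam (a * h))))) ?leq_subr //.
by apply: eq_bigr => h _; case: ifP => _; rewrite ?mulr0 // mulrCA.
Qed.

End ResidueCharacter.

Section FunctionalEquation.

Variables (k : finFieldType) (d1 : nat) (C : 'M[k]_d1.+1).
Hypotheses (k2 : (2 : k) != 0) (f_sep : separable_poly (char_poly C)).
Local Notation q := #|k|.
Local Notation d := d1.+1.

Let q_gt1 : (1 < q)%N := finNzRing_gt1 k.

Let sum_neq0_const (x : int) : \sum_(c : k | c != 0) x = q.-1%:Z * x.
Proof.
rewrite sumr_const -mulr_natl natz; congr (Posz _ * _).
by rewrite -(cardC1 (0 : k)); apply: eq_card => c.
Qed.

(** Poisson summation with translate [X^n] and kernel [qchar]. There [lam (X^n h)] is the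
    coefficient of [h] in degree [d1 - n], the highest one allowed, so only [h] of exactly this
    degree survive. For odd [d], scaling [h] by [c] gives [qchar c] twice, which cancels, and each
    monic polynomial is counted [q - 1] times. *)
Lemma monic_sum_dual : odd d -> exists G : int, forall n, (n <= d1)%N ->
  G * monic_sum C n = (q ^ n)%:Z * q.-1%:Z * monic_sum C (d1 - n).
Proof.
move=> d_odd.
have chid (c : k) : c != 0 -> qchar q c ^+ d = qchar q c.
  by move=> c0; rewrite -[d]odd_double_half d_odd -mul2n exprD exprM qchar_sqr // expr1n mulr1.
exists (fourier C (qchar q) 1) => n n_d.
have := poisson k2 f_sep (sum_qchar k2) 'X^n (leqW n_d).
rewrite -/(monic_sum C n) => ->; rewrite -mulrA; congr (_ * _).
rewrite subSn //; set m := (d1 - n)%N.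
pose F (h : {poly k}) := rchar C h * qchar q h`_m.
rewrite (eq_bigr (fun h : 'rV_m.+1 => F (rVpoly h))); last first.
  move=> h _; congr (_ * qchar _ _); rewrite lam_small.
    by rewrite mulrC coefMXn ltnNge n_d.
  have [->|h0] := eqVneq (rVpoly h) 0; first by rewrite mulr0 size_poly0.
  rewrite mulrC size_mulXn // -(subnKC n_d) -addnS leq_add2l; exact: size_poly.
rewrite sum_polyC_X (bigD1 0) //= big1 ?add0r; last first.
  by move=> w _; rewrite scale0r add0r /F nth_default ?size_poly // qchar0 mulr0.
rewrite -sum_neq0_const; apply: eq_bigr => c c0; rewrite (sum_scale _ F c0).
apply: eq_bigr => w _; rewrite /F rcharZ // chid // coefZ coefD coefXn eqxx.
rewrite [(rVpoly w)`_m]nth_default ?size_poly // addr0 mulr1 mulrC mulrA -expr2 qchar_sqr //.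
by rewrite mul1r.
Qed.

Lemma all_sum_dual : exists G : int, forall n, (n <= d)%N ->
  G * all_sum C n = (q ^ n)%:Z * q.-1%:Z * all_sum C (d - n).
Proof.
(* The sum of the nontrivial additive characters of [k]. With translate 0 only its value [q - 1] at
   0 enters on the dual side. *)
pose kap (x : k) : int := q%:Z * (x == 0)%:Z - 1.
have sum_kap : \sum_x kap x = 0.
  rewrite /kap sumrB -mulr_sumr (bigD1 0) //= eqxx big1 => [|x /negPf-> //].
  by rewrite addr0 mulr1 sumr_const cardT -cardE natz subrr.
exists (fourier C kap 1) => n n_d.
have := poisson k2 f_sep sum_kap 0 n_d.
rewrite (eq_bigr (fun w => rchar C (rVpoly w))) => [->|w _]; last by rewrite add0r.
rewrite -mulrA; congr (_ * _); rewrite mulr_sumr; apply: eq_bigr => h _.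
rewrite mul0r /lam mod0p coef0 /kap eqxx mulrC; congr (_ * _).
by move: q_gt1; case: #|k| => //= m _; lia.
Qed.

End FunctionalEquation.

(** * The Euler product *)

Section PrimeDecomposition.

Variables (k : finFieldType) (K : closedFieldType) (emb : {rmorphism k -> K}).
Local Notation q := #|k|.
Local Notation "h ^e" := (map_poly emb h) (at level 2, format "h ^e").
Local Notation frob := (@frob k K).
Local Notation period := (@period k K).
Local Notation orbit_poly := (@orbit_poly k K).

Let q_gt1 : (1 < q)%N := finNzRing_gt1 k.

(** For positive [m], the subfield of [K] with [q^m] elements. [undup] makes the list duplicate-free
    by construction. *)
Definition frob_fixed m : seq K :=
  undup (sval (closed_field_poly_normal ('X^(q ^ m) - 'X : {poly K}))).

Lemma frob_fixed_uniq m : uniq (frob_fixed m). Proof. exact: undup_uniq. Qed.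

Lemma mem_frob_fixed m x : (0 < m)%N -> (x \in frob_fixed m) = (frob m x == x).
Proof.
move=> m0; rewrite mem_undup; case: closed_field_poly_normal => rs /= rsE.
have Q1 : (1 < q ^ m)%N by rewrite -(expn0 q) ltn_exp2l.
have g0 : 'X^(q ^ m) - 'X != 0 :> {poly K}.
  by rewrite -size_poly_gt0 size_polyDl ?size_polyN ?size_polyX ?size_polyXn.
rewrite -root_prod_XsubC -(rootZ _ _ (_ : lead_coef ('X^(q ^ m) - 'X : {poly K}) != 0)) ?lead_coef_eq0 //.
by rewrite -rsE /root !hornerE subr_eq0.
Qed.

Lemma root_orbit_poly x m : (0 < m)%N -> root (orbit_poly x m) x.
Proof.
case: m => // m _; rewrite orbit_polyE big_ord_recl rootM root_XsubC /= frob0.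
by rewrite eqxx.
Qed.

Lemma orbit_polyD x a b : frob a x = x ->
  orbit_poly x (a + b) = orbit_poly x a * orbit_poly x b.
Proof.
move=> xa; rewrite !orbit_polyE big_split_ord /=; congr (_ * _).
by apply: eq_bigr => i _; rewrite addnC -frob_comp xa.
Qed.

Lemma orbit_poly_mul x e m : frob m x = x -> orbit_poly x (e * m) = orbit_poly x m ^+ e.
Proof.
move=> xm; elim: e => [|e IHe]; first by rewrite orbit_polyE big_ord0.
by rewrite mulSn orbit_polyD // IHe exprS.
Qed.

(** The minimal polynomial of [x] has [x] as a simple root, so its exponent in [h] is the
    multiplicity of [x]. *)
Lemma dvd_orbit_poly_exp x m (h : {poly k}) e : period x m -> h != 0 ->
  (orbit_poly x m ^+ e %| h^e) = (e <= mup x h^e)%N.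
Proof.
move=> xm; have [P [Pmon _ PE Pdvd]] := frob_minpoly emb xm.
have [m0 _ _] := xm.
have x_orb : x \in frob_orbit k x m.
  by apply/mapP; exists 0%N; rewrite ?frob0 ?mem_iota.
have mupP : mup x (orbit_poly x m) = 1%N.
  transitivity (count_mem x (frob_orbit k x m)); first exact: mu_prod_XsubC.
  by rewrite count_uniq_mem ?period_uniq ?x_orb.
have P0 : P^e != 0 by rewrite map_poly_eq0 monic_neq0.
rewrite -PE -rmorphXn dvdp_map; elim: e h => [|e IHe] h h0; first by rewrite expr0 dvd1p.
have [Ph|] := boolP (P %| h).
  have [g hE] := dvdpP _ _ Ph; have g0 : g != 0 by apply: contraNneq h0 => g0; rewrite hE g0 mul0r.
  have P_0 : P != 0 by apply: monic_neq0.
  rewrite hE exprSr dvdp_mul2r // IHe // rmorphM mupM ?map_poly_eq0 //.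
  by rewrite /= PE mupP addn1.
rewrite Pdvd => hx; rewrite (mupNroot hx); apply: contraNF hx => Ph.
by rewrite -Pdvd (dvdp_trans _ Ph) // exprS dvdp_mulr.
Qed.

Lemma card_multiples n m u : (0 < m)%N -> (u * m <= n)%N ->
  (\sum_(i < n) ((m %| i.+1) && (i.+1 %/ m <= u)) = u)%N.
Proof.
move=> m0 um; rewrite -big_mkcond sum1dep_card.
have lt_n (j : 'I_u) : ((j.+1 * m).-1 < n)%N.
  by rewrite prednK ?muln_gt0 // (leq_trans _ um) // leq_mul2r ltn_ord orbT.
rewrite -[RHS]card_ord -(card_imset (f := fun j => Ordinal (lt_n j))); last first.
  move=> i j [] /(congr1 S); rewrite !prednK ?muln_gt0 // => /eqP.
  by rewrite eqn_pmul2r // eqSS => /eqP/val_inj.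
apply: eq_card => i; rewrite inE; apply/andP/imsetP => [[/dvdnP[e ie]]|[j _ ->]] /=.
  rewrite ie mulnK // => le_u; have e0 : (0 < e)%N by case: e ie {le_u}.
  have lt_e : (e.-1 < u)%N by rewrite prednK.
  by exists (Ordinal lt_e) => //; apply: val_inj; rewrite /= prednK // -ie.
by rewrite prednK ?muln_gt0 // dvdn_mull // mulnK.
Qed.

(* A root [x] of degree [m] and multiplicity [u] is counted once for each of
   [m, 2m, ..., um], hence [u] times. *)
Lemma count_orbit_divisors (h : {poly k}) n : h \is monic -> size h = n.+1 ->
  (\sum_(m < n) \sum_(x <- frob_fixed m.+1) (orbit_poly x m.+1 %| h^e)%R = n)%N.
Proof.
move=> hmon szh; have h0 := monic_neq0 hmon.
have [rs hE] := closed_field_poly_normal h^e.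
have hemon : h^e \is monic by rewrite map_monic.
rewrite (monicP hemon) scale1r in hE.
have szrs : size rs = n.
  by apply: succn_inj; rewrite -szh -(size_map_poly emb) hE size_prod_XsubC.
have inner m : (\sum_(x <- frob_fixed m.+1) (orbit_poly x m.+1 %| h^e)%R
    = \sum_(x <- undup rs) ((frob m.+1 x == x) && (orbit_poly x m.+1 %| h^e)%R))%N.
  rewrite -big_mkcond -[RHS]big_mkcond /= -big_filter -[RHS]big_filter.
  apply/perm_big/uniq_perm; rewrite ?filter_uniq ?undup_uniq // => x.
  rewrite !mem_filter mem_frob_fixed // mem_undup.
  case: (boolP (orbit_poly x m.+1 %| h^e)) => /=; last by rewrite andbF.
  move=> Ph; rewrite andbT; case: eqP => //= _; symmetry.
  by rewrite -root_prod_XsubC -hE -dvdp_XsubCl (dvdp_trans _ Ph) // dvdp_XsubCl root_orbit_poly.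
under eq_bigr do rewrite inner.
rewrite exchange_big /= -[RHS]szrs -sum1_size -[RHS]big_undup_iterop_count /=.
apply: eq_big_seq => x; rewrite mem_undup => x_rs; rewrite Monoid.iteropE iter_addn_0 mul1n.
have hx : root h^e x by rewrite hE root_prod_XsubC.
have [m _ xm] := exists_period h0 hx; have [m0 fmx _] := xm.
have muE : mup x h^e = count_mem x rs by rewrite hE mu_prod_XsubC.
rewrite -(@card_multiples n m (count_mem x rs)) //; last first.
  have := dvd_orbit_poly_exp (count_mem x rs) xm h0; rewrite muE leqnn.
  move=> /(dvdp_leq (monic_neq0 hemon)); rewrite -orbit_poly_mul // size_orbit_poly.
  by rewrite size_map_poly szh ltnS.
apply: eq_bigr => i _; congr nat_of_bool; rewrite (period_dvdn _ xm).
case: (boolP (m %| i.+1)%N) => //= /dvdnP[e ie].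
by rewrite ie orbit_poly_mul // (dvd_orbit_poly_exp _ xm) // mulnK // muE.
Qed.

(* The polynomial over [k] that [emb] sends to [orbit_poly x m]. *)
Definition frob_char m x : {poly k} :=
  \poly_(i < m.+1) odflt 0 [pick a | emb a == (orbit_poly x m)`_i].

Lemma frob_charP m x : frob m x = x ->
  [/\ frob_char m x \is monic, size (frob_char m x) = m.+1
    & (frob_char m x)^e = orbit_poly x m].
Proof.
move=> /(orbit_poly_base emb)[h [hmon szh hE]]; suff -> : frob_char m x = h by [].
apply/polyP => i; rewrite coef_poly -hE coef_map /=.
case: ltnP => [_|m_i]; last by rewrite nth_default // szh.
case: pickP => /= [a /eqP/fmorph_inj -> // | none].
by move: (none h`_i) => /=; rewrite eqxx.
Qed.

Lemma sum_monic_multiples (c : {poly k}) m n (F : {poly k} -> int) :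
  c \is monic -> size c = m.+1 -> (m <= n)%N ->
  \sum_(w : 'rV[k]_(n - m)) F (c * ('X^(n - m) + rVpoly w))
  = \sum_(h : 'rV[k]_n | c %| 'X^n + rVpoly h) F ('X^n + rVpoly h).
Proof.
move=> cmon szc m_n.
have szX j (w : 'rV[k]_j) : size ('X^j + rVpoly w) = j.+1.
  by rewrite size_polyDl size_polyXn // ltnS size_poly.
have Xmon j (w : 'rV[k]_j) : 'X^j + rVpoly w \is monic.
  by rewrite monicE lead_coefDl ?lead_coefXn // size_polyXn ltnS size_poly.
have sz_tail (g : {poly k}) j : g \is monic -> size g = j.+1 -> (size (g - 'X^j)%R <= j)%N.
  move=> gmon szg; apply/leq_sizeP => i j_i; rewrite coefB coefXn.
  move: j_i; rewrite leq_eqVlt => /orP[/eqP <-|j_i].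
    by rewrite eqxx; move: gmon; rewrite monicE /lead_coef szg => /eqP -> ; rewrite subrr.
  by rewrite gtn_eqF // subr0 nth_default // szg.
have rVK (g : {poly k}) j : g \is monic -> size g = j.+1 ->
    'X^j + rVpoly (poly_rV (g - 'X^j) : 'rV_j) = g.
  by move=> gmon szg; rewrite poly_rV_K ?sz_tail // addrC subrK.
have cg (w : 'rV[k]_(n - m)) : c * ('X^(n - m) + rVpoly w) \is monic by rewrite monicMl.
have szcg (w : 'rV[k]_(n - m)) : size (c * ('X^(n - m) + rVpoly w)) = n.+1.
  by rewrite size_monicM ?monic_neq0 // szc szX addSn /= addnS subnKC.
have gc (h : 'rV[k]_n) : c %| 'X^n + rVpoly h -> ('X^n + rVpoly h) = c * (('X^n + rVpoly h) %/ c).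
  by move=> ch; rewrite mulrC divpK.
have gmon (h : 'rV[k]_n) : c %| 'X^n + rVpoly h -> ('X^n + rVpoly h) %/ c \is monic.
  by move=> /gc hE; rewrite -(monicMl _ cmon) -hE.
have szg (h : 'rV[k]_n) : c %| 'X^n + rVpoly h -> size (('X^n + rVpoly h) %/ c) = (n - m).+1.
  by move=> ch; rewrite size_divp ?monic_neq0 // szc szX subSn.
rewrite [RHS](reindex_onto (fun w : 'rV_(n - m) => poly_rV (c * ('X^(n - m) + rVpoly w) - 'X^n))
  (fun h : 'rV_n => poly_rV (('X^n + rVpoly h) %/ c - 'X^(n - m)))) /=; last first.
  move=> h ch; rewrite rVK ?gmon ?szg // -gc // addrC addKr; exact: rVpolyK.
apply: eq_big => [w|w _]; last by rewrite rVK.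
rewrite rVK // dvdp_mulr //= mulrC mulpK ?monic_neq0 // addrC addKr.
by rewrite rVpolyK eqxx.
Qed.

Variables (d1 : nat) (C : 'M[k]_d1.+1).
Hypothesis k2 : (2 : k) != 0.
Local Notation d := d1.+1.

(* The sign corrects [rchar] so that its value on [frob_char m x] becomes the quadratic
   character of [f.[x]] in the field with [q ^ m] elements. *)
Definition Lcoef n : int := (qchar q (-1 : k) ^+ d) ^+ n * monic_sum C n.

Definition char_sum m : int :=
  \sum_(x <- frob_fixed m) qchar (q ^ m) (char_poly C)^e.[x].

(** The norm of [f(x)] is the product of [f] over the Frobenius orbit of [x], that is, the resultant
    of [f] and [frob_char m x]. Passing to [det (frob_char m x)(C)] costs the sign [(-1)^(d m)]. *)
Lemma qchar_rchar m x : (0 < m)%N -> frob m x = x ->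
  qchar (q ^ m) (char_poly C)^e.[x] = (qchar q (-1 : k) ^+ d) ^+ m * rchar C (frob_char m x).
Proof.
move=> m0 xm; have q_odd := odd_card_finField k2.
have [_ _ cE] := frob_charP xm.
rewrite -qchar_frob_norm //.
set D := \det (horner_mx C (frob_char m x)).
have -> : \prod_(i < m) frob i (char_poly C)^e.[x] = emb ((-1) ^+ (d * m) * D).
  rewrite rmorphM rmorph_sign /D /= -(det_map_mx emb) map_horner_mx cE det_horner_mx_prod_XsubC.
  rewrite size_map size_iota mulrA -exprD addnn -mul2n exprM sqrrN expr1n expr1n mul1r.
  rewrite big_map -[in iota 0 m](subn0 m) big_mkord -map_char_poly.
  by apply: eq_bigr => i _; rewrite horner_frob.
rewrite qchar_rmorph qcharM ?expf_card // ?finNzRing_gt1 //.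
by rewrite -exprM qcharX ?expf_card ?finNzRing_gt1.
Qed.

(** The logarithmic derivative of the L-function. By multiplicativity, a term [x] times a monic
    cofactor becomes a sum over the monic multiples of [frob_char], and [count_orbit_divisors] says
    how often each polynomial occurs. The minus sign reflects that [char_sum] is minus a power sum
    of reciprocal roots. *)
Lemma Lcoef_rec : newton_rec (fun m => - char_sum m) Lcoef.
Proof.
move=> N; rewrite -sumrN.
under [RHS]eq_bigr do rewrite mulNr opprK.
set eps := qchar q (-1 : k) ^+ d.
have chiM (m : 'I_N.+1) x : x \in frob_fixed m.+1 ->
    qchar (q ^ m.+1) (char_poly C)^e.[x] * Lcoef (N - m)
    = \sum_(h : 'rV[k]_N.+1) eps ^+ N.+1 * rchar C ('X^(N.+1) + rVpoly h)
        * (orbit_poly x m.+1 %| ('X^(N.+1) + rVpoly h)^e)%R%:R.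
  rewrite mem_frob_fixed // => /eqP xm; have [cmon szc cE] := frob_charP xm.
  rewrite qchar_rchar // /Lcoef -/eps mulrACA -exprD addSn subnKC; last by rewrite -ltnS.
  rewrite /monic_sum mulr_sumr mulr_sumr.
  rewrite -subSS (eq_bigr (fun w : 'rV[k]_(N.+1 - m.+1) => eps ^+ N.+1 * rchar C (frob_char m.+1 x * ('X^(N.+1 - m.+1) + rVpoly w)))); last first.
    by move=> w _; rewrite rcharM.
  rewrite (sum_monic_multiples (fun g => eps ^+ N.+1 * rchar C g) cmon szc) //.
  rewrite big_mkcond; apply: eq_bigr => h _; rewrite -cE dvdp_map.
  by case: ifP; rewrite ?mulr1 ?mulr0.
rewrite (eq_bigr (fun m : 'I_N.+1 => \sum_(h : 'rV[k]_N.+1) eps ^+ N.+1 * rchar C ('X^(N.+1) + rVpoly h) *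
  \sum_(x <- frob_fixed m.+1) (orbit_poly x m.+1 %| ('X^(N.+1) + rVpoly h)^e)%R%:R)); last first.
  move=> m _; rewrite /char_sum mulr_suml (eq_big_seq _ (chiM m)) exchange_big.
  by apply: eq_bigr => h _; rewrite mulr_sumr.
rewrite exchange_big /= /Lcoef /monic_sum -/eps !mulr_sumr; apply: eq_bigr => h _.
rewrite -mulr_sumr mulrC; congr (_ * _).
have hmon : 'X^(N.+1) + rVpoly h \is monic.
  by rewrite monicE lead_coefDl ?lead_coefXn // size_polyXn ltnS size_poly.
have szh : size ('X^(N.+1) + rVpoly h) = N.+2 by rewrite size_polyDl size_polyXn // ltnS size_poly.
apply: (etrans (congr1 (fun n : nat => n%:R) (esym (count_orbit_divisors hmon szh)))).
by rewrite natr_sum; apply: eq_bigr => m _; rewrite natr_sum.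
Qed.

End PrimeDecomposition.

(** * The L-polynomial *)

Lemma newton_rec_rmorph (R S : nzRingType) (f : {rmorphism R -> S}) (p c : nat -> R) :
  newton_rec p c -> newton_rec (f \o p) (f \o c).
Proof.
move=> pc m; rewrite /= -(rmorph_nat f) -rmorphM pc rmorphN rmorph_sum /=; congr (- _).
by apply: eq_bigr => k _; rewrite rmorphM.
Qed.

Lemma newton_rec_eq (R : nzRingType) (p p' c c' : nat -> R) :
  (forall k, p k.+1 = p' k.+1) -> c =1 c' -> newton_rec p c -> newton_rec p' c'.
Proof.
move=> pp cc pc m; rewrite -cc pc; congr (- _); apply: eq_bigr => k _.
by rewrite pp cc.
Qed.

(** Division by [1 - T]: it removes one reciprocal root equal to 1, and turns coefficients into
    partial sums. *)
Lemma newton_rec_partial_sum (R : comNzRingType) (p c : nat -> R) :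
  newton_rec p c -> newton_rec (fun k => p k - 1) (fun n => \sum_(m < n.+1) c m).
Proof.
move=> pc m; set s := fun n => \sum_(m < n.+1) c m.
have sS n : s n.+1 = s n + c n.+1 by rewrite /s big_ord_recr.
elim: m => [|m IHm].
  have := pc 0%N; rewrite !big_ord1 /= big_ord_recr big_ord1 /= !mul1r => ->; ring.
have sE : s m.+1 = \sum_(k < m.+2) c (m.+1 - k)%N.
  rewrite /s (reindex_inj rev_ord_inj) /=.
  by apply: eq_bigr => k _; rewrite subSS.
have -> : \sum_(k < m.+2) (p k.+1 - 1) * s (m.+1 - k)%N
    = \sum_(k < m.+1) (p k.+1 - 1) * s (m - k)%N + \sum_(k < m.+2) (p k.+1 - 1) * c (m.+1 - k)%N.
  rewrite big_ord_recr [in X in _ = _ + X]big_ord_recr /= subnn.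
  rewrite [in RHS]addrA -big_split /=; congr (_ + _ * _); last by rewrite /s big_ord1.
  apply: eq_bigr => k _; rewrite -mulrDr subSn ?sS // -ltnS.
  exact: ltn_ord.
rewrite opprD -IHm.
under [X in _ = _ - X]eq_bigr do rewrite mulrBl mul1r.
rewrite sumrB opprB -sE; have := pc m.+1 => /esym/eqP; rewrite eqr_oppLR => /eqP ->.
rewrite [X in _ * X = _]big_ord_recr /= -/(s m.+1) -[m.+2%:R]natr1; ring.
Qed.

Lemma prod_1subX (F : closedFieldType) (P : {poly F}) : P`_0 = 1 ->
  exists2 bs, size bs = (size P).-1 & P = \prod_(b <- bs) (1 - b *: 'X).
Proof.
move=> P0; have [zs PE] := closed_field_poly_normal P; set a := lead_coef P in PE.
have a0 : a != 0.
  by rewrite lead_coef_eq0; apply: contra_eq_neq P0 => ->; rewrite coef0 eq_sym oner_eq0.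
have zs0 : 0 \notin zs.
  by rewrite -root_prod_XsubC -(rootZ _ _ a0) -PE /root horner_coef0 P0 oner_eq0.
exists [seq z^-1 | z <- zs].
  by rewrite size_map PE size_scale // size_prod_XsubC.
have PE' : P = (a * \prod_(z <- zs) - z) *: \prod_(z <- zs) (1 - z^-1 *: 'X).
  rewrite PE -scalerA; congr (_ *: _); rewrite -mul_polyC rmorph_prod -big_split /=.
  apply: eq_big_seq => z z_zs; have z0 : z != 0 by apply: contraNneq zs0 => <-.
  rewrite mul_polyC scalerBr scalerA mulNr mulfV // scaleN1r opprK addrC.
  by rewrite -[in RHS]mul_polyC mulr1 rmorphN.
rewrite big_map {1}PE'; have := P0; rewrite PE' coefZ.
rewrite -(big_map (fun z => z^-1) xpredT (fun b => 1 - b *: 'X)) coef0_prod_1subX mulr1 => ->.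
by rewrite scale1r.
Qed.

Lemma exists_char_poly (R : comNzRingType) (f : {poly R}) n :
  f \is monic -> size f = n.+1 -> exists C : 'M[R]_n, char_poly C = f.
Proof.
move=> fmon szf; have <- : (size f).-1 = n by rewrite szf.
by exists (companionmx f); apply: companionmxK.
Qed.

(** The Gauss sum [G] is eliminated: the relation at 0 gives [G = e c_(2g)], and the one at [2g]
    then gives [c_(2g)^2 = q^(2g)]. Only a sign remains unknown. *)
Lemma dual_coefs (q g : nat) (G e : int) (c : nat -> int) : (0 < q)%N ->
  e != 0 -> c 0%N = 1 ->
  (forall i, (i <= g.*2)%N -> G * c i = (q ^ i)%:Z * e * c (g.*2 - i)%N) ->
  exists2 eps : int, eps ^+ 2 = 1 &
    forall i, (i <= g)%N -> c (g.*2 - i)%N = eps * (q ^ (g - i))%:Z * c i.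
Proof.
move=> q0 e0 c0 cP.
have GE : G = e * c g.*2.
  by have := cP 0%N (leq0n _); rewrite c0 subn0 expn0 mulr1 mul1r.
have qg : (q ^ g)%:Z != 0 :> int by rewrite eqz_nat expn_eq0 negb_and -lt0n q0.
have sq : c g.*2 ^+ 2 = (q ^ g)%:Z ^+ 2.
  have := cP g.*2 (leqnn _); rewrite subnn c0 mulr1 GE -mulrA mulrC => /(mulIf e0).
  by rewrite -expr2 => ->; rewrite -muln2 expnM expr2 -PoszM mulnn.
have [eps eps2 ce] : exists2 eps : int, eps ^+ 2 = 1 & c g.*2 = eps * (q ^ g)%:Z.
  move/eqP: sq; rewrite eqf_sqr => /orP[] /eqP ->; first by exists 1; rewrite ?mul1r.
  by exists (-1); rewrite ?mulN1r.
exists eps => // i i_g.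
have q_i : (q ^ i)%:Z * e != 0 by rewrite mulf_neq0 // eqz_nat expn_eq0 negb_and -lt0n q0.
apply: (mulfI q_i); rewrite -cP; last by rewrite (leq_trans i_g) // -addnn leq_addr.
rewrite GE ce -{1}(subnKC i_g) expnD PoszM; ring.
Qed.

Lemma num_points_qchar (k : finFieldType) g (f : {poly k}) : (2 : k) != 0 ->
  (num_points g f)%:Z
  = #|k|%:Z + 1 + (\sum_(x : k) qchar #|k| f.[x] + qchar #|k| f`_(g.*2.+2)).
Proof.
move=> k2; rewrite /num_points PoszD card_sqrt //.
have -> : #|[set P : k * k | P.2 ^+ 2 == f.[P.1]]|%:Z
    = #|k|%:Z + \sum_(x : k) qchar #|k| f.[x].
  rewrite -sum1dep_card -(pair_big_dep xpredT (fun x y => y ^+ 2 == f.[x]) (fun _ _ => 1%N)) /=.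
  under eq_bigr do rewrite sum1dep_card.
  rewrite -natz natr_sum; under eq_bigr do rewrite natz card_sqrt //.
  by rewrite big_split /= sumr_const cardT -cardE natz.
ring.
Qed.

Section LPolynomial.

Variables (k : finFieldType) (g d1 : nat) (C : 'M[k]_d1.+1).
Hypotheses (k2 : (2 : k) != 0) (f_sep : separable_poly (char_poly C)).
Local Notation q := #|k|.
Local Notation d := d1.+1.
Hypothesis hd : d = g.*2.+1 \/ d = g.*2.+2.

(* One less than the number of points at infinity. *)
Definition inf_excess : int := (~~ odd d)%:Z.

(* For even [d] the character is even, and its L-function has the factor [1 - T] removed. *)
Definition Lnum n : int := if odd d then Lcoef C n else \sum_(m < n.+1) Lcoef C m.

Let q_gt1 : (1 < q)%N := finNzRing_gt1 k.

Let eps := qchar q (-1 : k) ^+ d.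

Lemma eps_sqr : eps ^+ 2 = 1.
Proof. by rewrite -exprM mulnC exprM qchar_sqr ?expr1n // oppr_eq0 oner_eq0. Qed.

Lemma Lnum0 : Lnum 0 = 1.
Proof.
have c0 : Lcoef C 0 = 1 by rewrite /Lcoef monic_sum0.
by rewrite /Lnum big_ord1 c0 if_same.
Qed.

Lemma Lcoef_even n : ~~ odd d -> Lcoef C n = monic_sum C n.
Proof.
move=> de; rewrite /Lcoef -[d]odd_double_half (negPf de) add0n -mul2n exprM.
by rewrite qchar_sqr ?expr1n ?mul1r // oppr_eq0 oner_eq0.
Qed.

(** For even [d] the character ignores scalars, so each monic polynomial of degree at most [n]
    accounts for [q - 1] equal terms. *)
Lemma Lnum_even n : ~~ odd d -> all_sum C n.+1 = q.-1%:Z * Lnum n.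
Proof.
move=> de; rewrite /Lnum (negPf de) mulr_sumr.
elim: n.+1 => [|m IHm]; first by rewrite big_ord0 all_sum0.
rewrite big_ord_recr /= -IHm all_sumS // Lcoef_even //.
suff -> : \sum_(c : k | c != 0) qchar q c ^+ d = q.-1%:Z by [].
rewrite (eq_bigr (fun=> 1)) => [|c c0]; last first.
  by rewrite -[d]odd_double_half (negPf de) add0n -mul2n exprM qchar_sqr ?expr1n.
rewrite sumr_const -mulr_natl mulr1 natz; congr Posz.
by rewrite -(cardC1 (0 : k)); apply: eq_card => c.
Qed.

Lemma Lnum_large n : (g.*2 < n)%N -> Lnum n = 0.
Proof.
move=> n_big; have [d_odd|de] := boolP (odd d).
  have dE : d = g.*2.+1 by case: hd => // dE; move: d_odd; rewrite dE /= odd_double.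
  by rewrite /Lnum d_odd /Lcoef monic_sum_large ?mulr0 // dE.
have dE : d = g.*2.+2 by case: hd => // dE; move: de; rewrite dE /= odd_double.
have Ld : Lnum g.*2.+1 = 0.
  apply/eqP; have := Lnum_even g.*2.+1 de; rewrite -dE all_sum_d // => /esym/eqP.
  by rewrite mulf_eq0 eqz_nat; move: q_gt1; case: #|k| => // -[].
rewrite -(subnKC n_big); elim: (n - _)%N => [|m IHm]; first by rewrite addn0.
move: IHm; rewrite addnS /Lnum (negPf de) [in X in _ -> X]big_ord_recr /= => ->.
by rewrite add0r Lcoef_even // monic_sum_large // dE ltnS leq_addr.
Qed.

Lemma Lnum_dual : exists2 e : int, e ^+ 2 = 1 &
  forall i, (i <= g)%N -> Lnum (g.*2 - i) = e * (q ^ (g - i))%:Z * Lnum i.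
Proof.
have q1 : q.-1%:Z != 0 by rewrite eqz_nat; move: q_gt1; case: #|k| => // -[].
have [d_odd|de] := boolP (odd d).
  have dE : d1 = g.*2 by case: hd => [[]|dE] //; move: d_odd; rewrite dE /= odd_double.
  have [G GP0] := monic_sum_dual k2 f_sep d_odd.
  have GP i : (i <= g.*2)%N ->
      G * monic_sum C i = (q ^ i)%:Z * q.-1%:Z * monic_sum C (g.*2 - i).
    by rewrite -dE => /GP0.
  apply: (@dual_coefs q g G q.-1%:Z) => //; rewrite ?Lnum0 1?ltnW // => i i_g.
  have epsE : eps ^+ (g.*2 - i) = eps ^+ i.
    have e1 j : eps ^+ j * eps ^+ j = 1 by rewrite -expr2 -exprM mulnC exprM eps_sqr expr1n.
    rewrite -[LHS]mulr1 -(e1 i) mulrA -exprD subnK // -mul2n exprM eps_sqr.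
    by rewrite expr1n mul1r.
  by rewrite /Lnum d_odd /Lcoef -/eps epsE mulrCA GP // [in RHS]mulrCA.
have dE : d = g.*2.+2 by case: hd => // dE; move: de; rewrite dE /= odd_double.
have [G GP0] := all_sum_dual k2 f_sep.
have GP i : (i <= g.*2.+2)%N ->
    G * all_sum C i = (q ^ i)%:Z * q.-1%:Z * all_sum C (g.*2.+2 - i).
  by rewrite -dE => /GP0.
(* The additional [q] comes from the index shift in [Lnum_even]: duality is applied to [all_sum] at
   [i + 1]. *)
apply: (@dual_coefs q g G (q%:Z * q.-1%:Z)) => //; rewrite ?Lnum0 1?ltnW //.
  by rewrite mulf_neq0 // eqz_nat; move: q_gt1; case: #|k|.
move=> i i_g; apply: (mulfI q1); rewrite mulrCA -Lnum_even //.
rewrite GP ?ltnS 1?leqW // subSS subSn // Lnum_even // expnS PoszM; ring.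
Qed.

Lemma Lnum_rec (K : closedFieldType) (emb : {rmorphism k -> K}) :
  newton_rec (fun m => - (char_sum emb C m + inf_excess)) Lnum.
Proof.
have rec := Lcoef_rec emb C k2; have [d_odd|de] := boolP (odd d).
  apply: newton_rec_eq rec => [m|n]; last by rewrite /Lnum d_odd.
  by rewrite /inf_excess d_odd addr0.
apply: newton_rec_eq (newton_rec_partial_sum rec) => [m|n]; last by rewrite /Lnum (negPf de).
by rewrite /inf_excess de opprD.
Qed.

Lemma char_sum_finField (kn : finFieldType) (iota : {rmorphism k -> kn})
    (K : closedFieldType) (emb : {rmorphism kn -> K}) n :
  (0 < n)%N -> #|kn| = (q ^ n)%N ->
  char_sum (emb \o iota) C n = \sum_(x : kn) qchar #|kn| (map_poly iota (char_poly C)).[x].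
Proof.
move=> n0 knE; have fixE : perm_eq (frob_fixed k K n) [seq emb x | x : kn].
  apply: uniq_perm; first exact: frob_fixed_uniq.
    by rewrite map_inj_uniq ?enum_uniq //; apply: fmorph_inj.
  move=> y; rewrite mem_frob_fixed //; apply/eqP/mapP => [fy|[x _ ->]].
    have [|x ->] := @frob1_base kn K emb y; first by rewrite /frob expn1 knE.
    by exists x; rewrite ?mem_enum.
  by rewrite /frob -knE -rmorphXn expf_card.
rewrite /char_sum (perm_big _ fixE) /= big_map big_enum /= -knE.
apply: eq_bigr => x _; rewrite -(qchar_rmorph emb) -horner_map -map_poly_comp.
by [].
Qed.

Lemma num_points_char_sum (kn : finFieldType) (iota : {rmorphism k -> kn})
    (K : closedFieldType) (emb : {rmorphism kn -> K}) n :
  (0 < n)%N -> #|kn| = (q ^ n)%N ->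
  (num_points g (map_poly iota (char_poly C)))%:Z
  = (q ^ n)%:Z + 1 + (char_sum (emb \o iota) C n + inf_excess).
Proof.
move=> n0 knE; have kn2 : (2 : kn) != 0 by rewrite -(rmorph_nat iota) fmorph_eq0.
rewrite num_points_qchar // (char_sum_finField iota emb n0 knE) knE; congr (_ + (_ + _)).
set f := map_poly iota _; have szf : size f = d.+1 by rewrite size_map_poly size_char_poly.
rewrite /inf_excess; case: hd => dE; first by rewrite nth_default ?szf ?dE // qchar0 /= odd_double.
have -> : f`_(g.*2.+2) = lead_coef f by rewrite /lead_coef szf dE.
by rewrite lead_coef_map (monicP (char_poly_monic C)) rmorph1 qchar1 dE /= odd_double.
Qed.

Definition Lpoly : {poly int} := \poly_(i < g.*2.+1) Lnum i.

Lemma coef_Lpoly i : Lpoly`_i = Lnum i.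
Proof. by rewrite coef_poly; case: ltnP => // /Lnum_large. Qed.

Lemma size_Lpoly : size Lpoly = g.*2.+1.
Proof.
have [e e2 dual] := Lnum_dual; rewrite size_poly_eq //.
have := dual 0%N (leq0n g); rewrite !subn0 Lnum0 mulr1 => ->.
rewrite mulf_neq0 ?eqz_nat ?expn_eq0 ?negb_and ?(gtn_eqF (ltnW q_gt1)) //.
by apply: contra_eq_neq e2 => ->; rewrite expr0n.
Qed.

Lemma Lpoly_isLpoly : is_Lpoly g (char_poly C) Lpoly.
Proof.
split; first exact: size_Lpoly.
set P := map_poly (fun n : int => n%:~R : algC) Lpoly.
have coefP i : P`_i = (Lnum i)%:~R by rewrite coef_map_id0 ?coef_Lpoly.
have P0 : P`_0 = 1 by rewrite coefP Lnum0.
have [bs szbs PE] := prod_1subX P0; exists bs.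
split=> // [|n kn iota n0 knE].
  by rewrite szbs size_map_poly_id0 ?size_Lpoly // intr_eq0 lead_coef_eq0 -size_poly_gt0 size_Lpoly.
(* The closure depends on [kn], but the coefficients [Lnum] do not; by [newton_rec_power] they fix
   the power sums, so the one list [bs] serves all extensions. *)
have [K [emb _]] := countable_algebraic_closure kn.
have := newton_rec_rmorph (intr : {rmorphism int -> algC}) (Lnum_rec (emb \o iota)).
have Pnewton : newton_rec (fun k => \sum_(b <- bs) b ^+ k) (fun i => (Lnum i)%:~R : algC).
  by apply: newton_rec_eq (newton_prod bs) => // i /=; rewrite -PE coefP.
have c0 : (Lnum 0)%:~R = 1 :> algC by rewrite Lnum0.
move=> /(newton_rec_power c0 Pnewton) /(_ n.-1); rewrite prednK //= => ->.
rewrite -[LHS]/((num_points g (map_poly iota (char_poly C)))%:Z%:~R).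
rewrite (num_points_char_sum iota emb n0 knE) rmorphN opprK !rmorphD /= -natrX.
by [].
Qed.

End LPolynomial.

(** * Finite fields of prescribed degree *)

Lemma finField_extension (k : finFieldType) n : (0 < n)%N ->
  {kn : finFieldType & {iota : {rmorphism k -> kn} | #|kn| = (#|k| ^ n)%N}}.
Proof.
move=> n0; set q := #|k|; pose Q := (q ^ n)%N.
have q_gt1 : (1 < q)%N := finNzRing_gt1 k.
have Q_gt1 : (1 < Q)%N by rewrite -(expn0 q) ltn_exp2l.
pose P (R : nzRingType) : {poly R} := 'X^Q - 'X.
have P0 (F : fieldType) : P F != 0.
  by rewrite -size_poly_gt0 size_polyDl ?size_polyN ?size_polyX size_polyXn.
have szP (F : fieldType) : size (P F) = Q.+1.
  by rewrite size_polyDl ?size_polyN ?size_polyX size_polyXn.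
have [L splitL] := FinSplittingFieldFor (P0 k).
exists (FinFieldExtType L), (in_alg L); have [zs PE defL] := splitL.
have PLE : map_poly (in_alg L) (P k) = P L by rewrite rmorphB /= map_polyXn map_polyX.
rewrite PLE in PE.
have QL : Q%:R = 0 :> L.
  by rewrite natrX -(rmorph_nat (in_alg L)) natr_card_finField rmorph0 expr0n gtn_eqF.
have uniq_zs : uniq zs.
  rewrite -separable_prod_XsubC -(eqp_separable PE) unlock /P.
  by rewrite derivB derivXn derivX -mulr_natl -polyC_natr QL mul0r sub0r -[X in coprimep _ X]scaleN1r coprimepZr ?oppr_eq0 ?oner_eq0 // coprimep1.
have /finField_galois_generator[/= a _ Da] : (1 <= {:L})%VS by apply: sub1v.
rewrite dimv1 expn1 in Da.
(* The roots of [X^Q - X] are the fixed points of the [n]-th power of the Frobenius [a]. They thus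
   form a subfield, and as they generate [L] they are all of [L]. *)
pose E := fixedSpace (a ^+ n)%g.
suffices /eq_card -> : FinFieldExtType L =i zs.
  apply: succn_inj; rewrite (card_uniqP _) //= -(size_prod_XsubC _ id).
  by rewrite -(eqp_size PE) szP.
have in_zs : zs =i E.
  move=> z; rewrite -root_prod_XsubC -(eqp_root PE) (sameP fixedSpaceP eqP).
  rewrite /root !hornerE subr_eq0 /= /Q; congr (_ == z).
  elim: (n) => [|i IHi]; first by rewrite gal_id.
  by rewrite expgSr expnSr exprM IHi galM ?Da ?memvf.
suffices defE : E = {:L}%VS by move=> z; rewrite in_zs defE memvf.
apply/eqP; rewrite eqEsubv subvf -defL -[E]subfield_closed agenvS //.
by rewrite subv_add sub1v; apply/span_subvP=> z; rewrite in_zs.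
Qed.

(** * The Hasse-Witt matrix *)

Lemma sum_expr_finField (k : finFieldType) i :
  \sum_(x : k) x ^+ i = if (0 < i)%N && (#|k|.-1 %| i)%N then -1 else 0.
Proof.
have q_gt1 : (1 < #|k|)%N := finNzRing_gt1 k.
have expq1 (x : k) : x != 0 -> x ^+ #|k|.-1 = 1.
  by move=> x0; apply: (mulfI x0); rewrite -exprS prednK ?expf_card ?mulr1 // ltnW.
have card_units : #|[set x : k | x != 0]| = #|k|.-1.
  by rewrite -(cardC1 (0 : k)); apply: eq_card => x; rewrite !inE.
(* Here [0^0 = 1], so exponent 0 sums to [q], which vanishes in [k]. *)
case: (posnP i) => [->|i0] /=.
  by rewrite (eq_bigr (fun=> 1)) // sumr_const natr_card_finField.
case: (boolP (_ %| i)%N) => [/dvdnP[e ie]|q_i].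
  rewrite (bigD1 0) //= expr0n (gtn_eqF i0).
  rewrite add0r (eq_bigr (fun=> 1)) => [|x x0]; last by rewrite ie mulnC exprM expq1 ?expr1n.
  transitivity (#|k|.-1%:R : k).
    rewrite sumr_const -card_units; congr (_ *+ _); apply: eq_card => x; by rewrite inE.
  by apply/eqP; rewrite -subr_eq0 opprK natr1 prednK ?natr_card_finField // ltnW.
have [y y0 yi] : exists2 y : k, y != 0 & y ^+ i != 1.
  have [/existsP[y /andP[]]|] := boolP [exists y : k, (y != 0) && (y ^+ i != 1)].
    by exists y.
  rewrite negb_exists => /forallP all1.
  pose r := (i %% #|k|.-1)%N; have r0 : (0 < r)%N by rewrite lt0n.
  have : (size (enum [set x : k | x != 0%R]) <= r)%N.
    apply: max_unity_roots (enum_uniq _) => //; apply/allP => y.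
    rewrite mem_enum inE => y0; have := all1 y; rewrite y0 negbK => /eqP yi.
    by rewrite unity_rootE /r -[X in _ == X]yi {2}(divn_eq i #|k|.-1) exprD mulnC exprM expq1 // expr1n mul1r.
  by rewrite -cardE card_units leqNgt ltn_mod -subn1 subn_gt0 q_gt1.
set S := LHS; apply/eqP; have : (y ^+ i - 1) * S = 0.
  rewrite mulrBl mul1r /S mulr_sumr [X in _ - X](reindex_inj (mulfI y0)) /=.
  by apply/eqP; rewrite subr_eq0; apply/eqP/eq_bigr => x _; rewrite exprMn.
by move/eqP; rewrite mulf_eq0 subr_eq0 (negPf yi).
Qed.

Lemma half_pred_mul m n : odd m -> odd n ->
  ((m * n).-1./2 = m.-1./2 + m * n.-1./2)%N.
Proof.
move=> mo no; apply: double_inj; rewrite doubleD doubleMr !half_pred_odd ?oddM ?mo //.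
by case: m mo => // m _; case: n no => // n _; rewrite mulnS addSn.
Qed.

Section HasseWitt.

Variables (R : comNzRingType) (p : nat).
Hypothesis charRp : p \in [pchar R].

Lemma poly_exp_pchar a (h : {poly R}) :
  h ^+ (p ^ a) = \sum_(t < size h) h`_t ^+ (p ^ a) *: 'X^(t * p ^ a).
Proof.
have pP : p \in [pchar {poly R}].
  by rewrite inE (pcharf_prime charRp) /= -polyC_natr (pcharf0 charRp) eqxx.
have pnat : [pchar {poly R}].-nat (p ^ a)%N.
  by rewrite pnatX; apply/orP; left; rewrite pnatE // (pcharf_prime charRp).
rewrite -[h in LHS]coefK poly_def (big_morph (fun x => x ^+ (p ^ a)) (id1 := 0) (op1 := +%R)) //.
- by apply: eq_bigr => t _; rewrite exprZn -exprM.
- by move=> x y; apply: exprDn_pchar.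
- by rewrite expr0n expn_eq0; case: p (pcharf_prime charRp).
Qed.

Lemma coef_mul_exp_pchar a (A B : {poly R}) N T :
  (N < T * p ^ a)%N -> (A * B ^+ (p ^ a))`_N =
  \sum_(t < T) if (t * p ^ a <= N)%N then A`_(N - t * p ^ a) * B`_t ^+ (p ^ a) else 0.
Proof.
move=> N_T; rewrite poly_exp_pchar mulr_sumr coef_sum.
under eq_bigr do rewrite -scalerAr coefZ coefMXn mulrC.
pose F t := if (t * p ^ a <= N)%N then A`_(N - t * p ^ a) * B`_t ^+ (p ^ a) else 0.
have pa0 : (p ^ a != 0)%N by rewrite expn_eq0; case: p (pcharf_prime charRp).
rewrite (eq_bigr (fun t : 'I_(size B) => F t)) => [|t _]; last first.
  by rewrite /F ltnNge; case: leqP; rewrite /= ?mul0r.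
have ext n : (forall t, (n <= t)%N -> F t = 0) -> forall m, (n <= m)%N ->
    \sum_(t < n) F t = \sum_(t < m) F t.
  move=> Fn m n_m; rewrite -(subnKC n_m) big_split_ord /= [X in _ = _ + X]big1 ?addr0 // => t _.
  by rewrite Fn // leq_addr.
have FB t : (size B <= t)%N -> F t = 0.
  by move=> B_t; rewrite /F (nth_default _ B_t) expr0n (negPf pa0) mulr0 if_same.
have FT t : (T <= t)%N -> F t = 0.
  move=> T_t; rewrite /F leqNgt (leq_trans N_T) //.
  by rewrite leq_mul2r T_t orbT.
by rewrite (ext _ FB (maxn (size B) T)) ?leq_maxl // -(ext _ FT) // leq_maxr.
Qed.

(* Rows and columns are numbered from 1 in the literature, hence the successors; the
   subtraction does not truncate when [g <= Q]. *)
Definition hasse_witt g Q (f : {poly R}) : 'M[R]_g :=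
  \matrix_(i, j) (f ^+ Q.-1./2)`_(i.+1 * Q - j.+1).

(** Semilinearity of the Cartier operator in coordinates: [f^((Q Q' - 1)/2)] is [f^((Q-1)/2)] times
    the [Q]-th power of [f^((Q'-1)/2)], and the latter has only exponents divisible by [Q]. *)
Lemma hasse_witt_mul g a b (f : {poly R}) : odd p -> (g < p ^ a)%N -> (g <= p ^ b)%N ->
  (size f <= g.*2.+3)%N ->
  hasse_witt g (p ^ a * p ^ b) f
  = map_mx (fun x => x ^+ (p ^ a)) (hasse_witt g (p ^ b) f) *m hasse_witt g (p ^ a) f.
Proof.
move=> p_odd g_a g_b szf; apply/matrixP => i j; rewrite !mxE.
set Q := (p ^ a)%N; set Q' := (p ^ b)%N.
have Qo : odd Q by rewrite oddX p_odd orbT.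
have Q'o : odd Q' by rewrite oddX p_odd orbT.
have Q0 : (0 < Q)%N := odd_gt0 Qo.
have Q'0 : (0 < Q')%N := odd_gt0 Q'o.
have -> : f ^+ (Q * Q').-1./2 = f ^+ Q.-1./2 * (f ^+ Q'.-1./2) ^+ Q.
  rewrite -exprM -exprD; congr (_ ^+ _).
  by rewrite half_pred_mul //; congr (_ + _)%N; apply: mulnC.
have j_Q : (j < Q)%N by rewrite (leq_trans (ltn_ord j)) // ltnW.
have g_iQ' : (g <= i.+1 * Q')%N by rewrite (leq_trans g_b) // leq_pmull.
set T := (i.+1 * Q')%N; have TQ : (i.+1 * (Q * Q') = T * Q)%N by rewrite /T; lia.
have Q_T : (0 < T)%N by rewrite muln_gt0.
have NT : (i.+1 * (Q * Q') - j.+1 < T * Q)%N by rewrite TQ ltn_subrL muln_gt0 Q_T.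
rewrite (coef_mul_exp_pchar _ _ NT) TQ -/Q (reindex_inj rev_ord_inj) /=.
pose F m := (f ^+ Q'.-1./2)`_(T - m.+1) ^+ Q * (f ^+ Q.-1./2)`_(m.+1 * Q - j.+1).
rewrite (eq_bigr (fun m : 'I_T => F m)) => [|m _]; last first.
  have mT := ltn_ord m; have mQ : (m.+1 * Q <= T * Q)%N by rewrite leq_mul2r mT orbT.
  have jm : (j.+1 <= m.+1 * Q)%N by rewrite (leq_trans j_Q) // leq_pmull.
  rewrite mulnBl leq_sub2l // /F mulrC; congr (_ * _`_ _); lia.
have g_T : (g <= T)%N by [].
rewrite -(big_mkord xpredT F) (big_cat_nat (n := g)) //= big_mkord [X in _ + X]big1_seq ?addr0.
  by apply: eq_bigr => m _; rewrite !mxE.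
(* For [m >= g] the index [(m+1) Q - (j+1)] exceeds [(g+1)(Q-1)], which bounds the degree of
   [f^((Q-1)/2)]. *)
move=> m /=; rewrite mem_index_iota => /andP[g_m _]; rewrite /F [X in _ * X]nth_default ?mulr0 //.
rewrite (leq_trans (size_poly_exp_leq _ _)) //.
have le_f : ((size f).-1 * Q.-1./2 <= g.+1 * Q.-1)%N.
  have := half_pred_odd Qo; set h := Q.-1./2 => <-.
  by rewrite -mul2n mulnA leq_mul2r; apply/orP; right; move: szf; lia.
apply: leq_ltn_trans le_f _; rewrite ltn_subRL.
have : (g.+1 * Q <= m.+1 * Q)%N by rewrite leq_mul2r ltnS g_m orbT.
have j_g := ltn_ord j; apply: leq_trans.
by rewrite -[in X in (_ <= X)%N](prednK Q0) mulnS ltn_add2r ltnS.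
Qed.

End HasseWitt.

Lemma hasse_witt_map (R S : comNzRingType) (phi : {rmorphism R -> S}) g Q (f : {poly R}) :
  map_mx phi (hasse_witt g Q f) = hasse_witt g Q (map_poly phi f).
Proof. by apply/matrixP => i j; rewrite !mxE -rmorphXn coef_map. Qed.

Lemma coef_exp_top (R : comNzRingType) (f : {poly R}) n m :
  (size f <= n.+1)%N -> (f ^+ m)`_(n * m) = f`_n ^+ m.
Proof.
move=> szf; elim: m => [|m IHm]; first by rewrite muln0 coef1.
have szm : (size (f ^+ m)%R <= (n * m).+1)%N.
  rewrite (leq_trans (size_poly_exp_leq _ _)) // ltnS leq_mul2r.
  by apply/orP; right; move: szf; lia.
have n_lt : (n < (n * m.+1).+1)%N by rewrite ltnS mulnS leq_addr.
have e : (n * m.+1 - n = n * m)%N by rewrite mulnS addKn.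
rewrite exprS coefM (bigD1 (Ordinal n_lt)) //= e IHm big1 ?addr0 ?exprS // => i ni.
have [i_n|n_i] := ltnP i n; last first.
  by rewrite nth_default ?mul0r // (leq_trans szf) // ltn_neqAle n_i andbT eq_sym.
rewrite [X in _ * X]nth_default ?mulr0 // (leq_trans szm) // ltn_subRL.
by move: i_n; move: (nat_of_ord i) => i'; rewrite mulnS ltn_add2r.
Qed.

Lemma sum_multiples (R : nmodType) (F : nat -> R) n m : (0 < m)%N ->
  \sum_(i < (n * m).+1) (if (0 < i)%N && (m %| i)%N then F i else 0) = \sum_(j < n) F (j.+1 * m)%N.
Proof.
move=> m0; elim: n => [|n IHn]; first by rewrite big_ord1 big_ord0.
rewrite [RHS]big_ord_recr /= -IHn.
have -> : (n.+1 * m).+1 = ((n * m).+1 + m.-1.+1)%N by rewrite prednK // mulSn addnC addSn.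
rewrite big_split_ord /= [X in _ + X = _]big_ord_recr /= [X in _ + (X + _)]big1 ?add0r => [|i _]; last first.
  rewrite addSn /= -addnS dvdn_addr ?dvdn_mull //.
  by rewrite gtnNdvd // -ltn_predRL.
congr (_ + _); rewrite addSn /= -addnS prednK // -mulSnr dvdn_mull //.
Qed.

Lemma num_points_mod (k : finFieldType) g (f : {poly k}) : (2 : k) != 0 ->
  (size f <= g.*2.+3)%N -> (num_points g f)%:R = 1 - \tr (hasse_witt g #|k| f) :> k.
Proof.
move=> k2 szf; set q := #|k|; have q_odd := odd_card_finField k2.
have q_gt1 : (1 < q)%N := finNzRing_gt1 k.
rewrite -[LHS]/((num_points g f)%:Z%:~R) num_points_qchar // !rmorphD /= rmorph_sum /=.
rewrite -[q%:Z%:~R]/(q%:R) natr_card_finField add0r; congr (_ + _).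
rewrite qcharE ?expf_card //; under eq_bigr do rewrite qcharE ?expf_card // -horner_exp.
set F := f ^+ q.-1./2.
have FN : (size F <= (g.+1 * q.-1).+1)%N.
  rewrite (leq_trans (size_poly_exp_leq _ _)) // ltnS -[in leqRHS](half_pred_odd q_odd).
  rewrite -mul2n mulnA leq_mul2r; apply/orP; right; move: szf; lia.
under eq_bigr do rewrite (horner_coef_wide _ FN).
rewrite exchange_big /=; under eq_bigr do rewrite -mulr_sumr sum_expr_finField -/q.
rewrite (eq_bigr (fun i : 'I_(g.+1 * q.-1).+1 =>
    if (0 < i)%N && (q.-1 %| i)%N then - F`_i else 0)); last first.
  by move=> i _; case: ifP => _; rewrite ?mulr0 // mulrN1.
rewrite (sum_multiples (fun i => - F`_i)); last by rewrite -subn1 subn_gt0.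
rewrite sumrN big_ord_recr /= opprD.
(* The last multiple of [q - 1] is not a trace entry; it cancels the term of the points at
   infinity. *)
have -> : F`_(g.+1 * q.-1) = f`_(g.*2.+2) ^+ q.-1./2.
  rewrite -(coef_exp_top _ szf) /F; congr _`_ _.
  have -> : (g.*2.+2 = g.+1 * 2)%N by rewrite muln2 doubleS.
  by rewrite -mulnA mul2n half_pred_odd.
rewrite addrNK; congr (- _); apply: eq_bigr => i _; rewrite !mxE; congr _`_ _.
by rewrite -subn1 mulnBr muln1.
Qed.

Section HasseWittPower.

Variables (k : finFieldType) (p : nat).
Hypotheses (charkp : p \in [pchar k]) (p_odd : odd p).

(** The [q]-power map is trivial on [k], so the twisted product of [hasse_witt_mul] is an ordinary
    power. *)
Lemma hasse_witt_pow g (f : {poly k}) n : (g.+1 < p)%N -> (size f <= g.+1.*2.+3)%N ->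
  hasse_witt g.+1 (#|k| ^ n.+1) f = hasse_witt g.+1 #|k| f ^+ n.+1.
Proof.
move=> g_p szf; have qE : #|k| = (p ^ logn p #|k|)%N := card_pprimeChar charkp.
have r0 : (0 < logn p #|k|)%N.
  by rewrite -(ltn_exp2l _ _ (prime_gt1 (pcharf_prime charkp))) -qE finNzRing_gt1.
have p_le r : (0 < r)%N -> (p <= p ^ r)%N.
  by case: r => // r _; rewrite expnS leq_pmulr // expn_gt0 (prime_gt0 (pcharf_prime charkp)).
elim: n => [|n IHn]; first by rewrite expn1 expr1.
rewrite expnS [in (#|k| ^ n.+1)%N]qE -expnM {1}qE (hasse_witt_mul charkp) //.
- rewrite expnM -qE IHn [RHS]exprSr; congr (_ *m _).
  by apply/matrixP => i j; rewrite mxE expf_card.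
- by rewrite (leq_trans g_p) // p_le.
by rewrite ltnW // (leq_trans g_p) // p_le // muln_gt0 r0.
Qed.

Lemma det_hasse_witt_pow (R : idomainType) g (f : {poly R}) r :
  p \in [pchar R] -> (g < p)%N -> (size f <= g.*2.+3)%N ->
  (\det (hasse_witt g (p ^ r.+1) f) == 0) = (\det (hasse_witt g p f) == 0).
Proof.
move=> charRp g_p szf; elim: r => [|r IHr]; first by rewrite expn1.
have p_le : (p <= p ^ r.+1)%N.
  by rewrite expnS leq_pmulr // expn_gt0 (prime_gt0 (pcharf_prime charRp)).
rewrite expnS -{1}[p]expn1 (hasse_witt_mul charRp) ?expn1 //; last by rewrite ltnW // (leq_trans g_p).
pose phi : {rmorphism R -> R} := pFrobenius_aut charRp.
have phiE x : phi x = x ^+ p by [].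
rewrite -(eq_map_mx _ phiE) det_mulmx det_map_mx mulf_eq0 phiE expf_eq0 IHr.
by rewrite (prime_gt0 (pcharf_prime charRp)) orbb.
Qed.

End HasseWittPower.

(** * The L-polynomial modulo p *)

Section LpolyMod.

Variables (k : finFieldType) (g : nat) (f : {poly k}).

Lemma Lpoly_coef0 L : is_Lpoly g f L -> L`_0 = 1.
Proof.
case=> _ [bs [_ LE _]]; apply: (intr_inj (R := algC)).
have -> : (L`_0)%:~R = (\prod_(b <- bs) (1 - b *: 'X))`_0 :> algC.
  by rewrite -LE coef_map_id0.
exact: coef0_prod_1subX.
Qed.

(** The power sum of index [n + 1], computed as an integer from one chosen extension. It depends on
    [f] alone and can be reduced modulo [p], unlike the list of reciprocal roots. *)
Definition power_sum n : int :=
  let: existT kn (exist iota _) := finField_extension k (ltn0Sn n) in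
  (#|k| ^ n.+1)%:Z + 1 - (num_points g (map_poly iota f))%:Z.

Lemma Lpoly_newton L : is_Lpoly g f L ->
  newton_rec (fun n => power_sum n.-1) (nth 0 L).
Proof.
case=> _ [bs [_ LE points]].
have coefL i : (L`_i)%:~R = (\prod_(b <- bs) (1 - b *: 'X))`_i :> algC.
  by rewrite -LE coef_map_id0.
have sE n : (power_sum n)%:~R = \sum_(b <- bs) b ^+ n.+1 :> algC.
  rewrite /power_sum; case: finField_extension => kn [iota knE].
  have := points n.+1 kn iota isT knE.
  rewrite -[LHS]/((num_points g (map_poly iota f))%:Z%:~R) intrD intrN intrD => ->.
  by rewrite -natrX; ring.
move=> m; apply: (intr_inj (R := algC)).
rewrite intrM intrN rmorph_sum rmorph_nat /= coefL.
have := newton_prod bs m => ->; congr (- _); apply: eq_bigr => i _.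
by rewrite intrM sE coefL.
Qed.

Lemma Lpoly_uniq L L' : is_Lpoly g f L -> is_Lpoly g f L' -> L = L'.
Proof.
move=> hL hL'; apply/polyP => i.
apply: (newton_rec_coef (N := i) _ _ (Lpoly_newton hL) (Lpoly_newton hL')) => //.
  by move=> m /andP[m0 _]; apply/lregP; rewrite natz eqz_nat -lt0n.
by rewrite !Lpoly_coef0.
Qed.

End LpolyMod.

Lemma Lpoly_mod (k : finFieldType) p g (f : {poly k}) L :
  p \in [pchar k] -> odd p -> (0 < g < p)%N -> (size f <= g.*2.+3)%N -> is_Lpoly g f L ->
  (L`_g)%:~R = (-1) ^+ g * \det (hasse_witt g #|k| f) :> k.
Proof.
case: g => // g charkp p_odd /= g_p szf hL; set A := hasse_witt _ _ _.
have [K [emb _]] := countable_algebraic_closure k.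
have [ls AE] := closed_field_poly_normal (char_poly (map_mx emb A)).
rewrite (monicP (char_poly_monic _)) scale1r in AE.
have k2 := odd_pchar_two charkp p_odd.
have sE n : (power_sum g.+1 f n)%:~R = \tr (A ^+ n.+1).
  rewrite /power_sum; case: finField_extension => kn [iota knE].
  have kn2 : (2 : kn) != 0 by rewrite -(rmorph_nat iota) fmorph_eq0.
  apply: (fmorph_inj iota); rewrite rmorph_int intrB intrD.
  have -> : (#|k| ^ n.+1)%:Z%:~R = 0 :> kn.
    by rewrite -[LHS]/((#|k| ^ n.+1)%:R) -knE natr_card_finField.
  rewrite -[_%:Z%:~R]/((num_points g.+1 (map_poly iota f))%:R) num_points_mod ?size_map_poly //.
  rewrite knE -hasse_witt_map trace_map_mx -(hasse_witt_pow charkp) //; ring.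
have A_newton : newton_rec (fun n => (\tr (A ^+ n))) (fun i => (L`_i)%:~R : k).
  move=> m; have := congr1 (fun z : int => z%:~R : k) (Lpoly_newton hL m).
  rewrite intrM intrN rmorph_sum rmorph_nat /= => ->; congr (- _); apply: eq_bigr => i _.
  by rewrite intrM sE.
have := newton_rec_rmorph emb A_newton.
have D_newton : newton_rec (emb \o (fun n => \tr (A ^+ n)))
    (fun i => (\prod_(l <- ls) (1 - l *: 'X))`_i).
  apply: newton_rec_eq (newton_prod ls) => // n /=.
  by rewrite -trace_map_mx rmorphXn /= (mxtrace_exp_spectrum AE).
move=> L_newton; apply: (fmorph_inj emb).
have -> : emb (L`_g.+1)%:~R = (\prod_(l <- ls) (1 - l *: 'X))`_g.+1.
  (* The integers up to the genus are less than [p], hence cancellable in [K]. *)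
  apply: (newton_rec_coef (N := g.+1) _ _ L_newton D_newton) => //.
    move=> m /andP[m0 m_g]; apply/lregP; rewrite -(rmorph_nat emb) fmorph_eq0.
    by rewrite -(dvdn_pcharf charkp) gtnNdvd // (leq_ltn_trans m_g).
  by rewrite /= (Lpoly_coef0 hL) rmorph1 coef0_prod_1subX.
have := coef_prod_1subX ls; rewrite (size_spectrum AE) => ->.
by rewrite -(det_spectrum AE) det_map_mx rmorphM rmorph_sign.
Qed.

(** * Newton polygons *)

Section NewtonPolygon.

Variables (p r g : nat) (L : {poly int}) (e : int).
Local Notation q := (p ^ r)%N.
Hypotheses (p_pr : prime p) (r_gt0 : (0 < r)%N) (g_gt0 : (0 < g)%N).
Hypotheses (szL : size L = g.*2.+1) (L0 : L`_0 = 1) (e2 : e ^+ 2 = 1).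
Hypothesis L_dual : forall i, (i <= g)%N -> L`_(g.*2 - i) = e * (q ^ (g - i))%:Z * L`_i.

Local Notation v i := (vq p q L`_i).

Let r_neq0 : r%:R != 0 :> rat. Proof. by rewrite pnatr_eq0 -lt0n. Qed.

Let vqE a : vq p q a = (logn p `|a|%N)%:R / r%:R.
Proof. by rewrite /vq pfactorK. Qed.

Lemma vq_ge0 a : 0 <= vq p q a.
Proof. by rewrite vqE divr_ge0 ?ler0n. Qed.

Lemma vq_eq0 a : a != 0 -> (vq p q a == 0) = ~~ (p %| `|a|)%N.
Proof.
move=> a0; rewrite vqE mulf_eq0 invr_eq0 (negPf r_neq0) orbF pnatr_eq0.
by rewrite -[LHS]negbK -lt0n logn_gt0 mem_primes p_pr absz_gt0 a0.
Qed.

Lemma vq_0 : v 0 = 0.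
Proof. by rewrite L0 vqE logn1 mul0r. Qed.

Let e_abs : `|e|%N = 1%N.
Proof. by move/eqP: e2; rewrite sqrf_eq1 => /orP[] /eqP ->. Qed.

Let L_neq0 i : (i <= g)%N -> (L`_(g.*2 - i) == 0) = (L`_i == 0).
Proof.
move=> i_g; rewrite L_dual // !mulf_eq0 eqz_nat expn_eq0 expn_eq0.
by rewrite (gtn_eqF (prime_gt0 p_pr)) -absz_eq0 e_abs.
Qed.

Lemma vq_dual i : (i <= g)%N -> L`_i != 0 -> v (g.*2 - i)%N = (g - i)%N%:R + v i.
Proof.
move=> i_g Li0; rewrite L_dual // !vqE !abszM e_abs mul1n absz_nat.
rewrite lognM ?absz_gt0 ?expn_gt0 ?(prime_gt0 p_pr) // -expnM pfactorK // natrD natrM.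
by field.
Qed.

Lemma vq_2g : v g.*2 = g%:R.
Proof. by have := vq_dual (leq0n g); rewrite !subn0 vq_0 addr0; apply; rewrite L0. Qed.

Lemma L2g_neq0 : L`_(g.*2) != 0.
Proof. by have := L_neq0 (leq0n g); rewrite subn0 L0 => ->. Qed.

Lemma coef_le i : L`_i != 0 -> (i <= g.*2)%N.
Proof. by apply: contra_neqT; rewrite -ltnNge => i_big; rewrite nth_default ?szL. Qed.

(** With [vq_ge0] this keeps the polygon above the one of an ordinary curve, through [(0,0)],
    [(g,0)] and [(2g,g)]. *)
Lemma vq_ge i : (g <= i)%N -> L`_i != 0 -> i%:R - g%:R <= v i.
Proof.
move=> g_i Li0; have i_2g := coef_le Li0.
have j_g : (g.*2 - i <= g)%N by move: g_i i_2g; lia.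
have iE : (i = g.*2 - (g.*2 - i))%N by rewrite subKn.
have Lj0 : L`_(g.*2 - i) != 0 by rewrite -(L_neq0 j_g) -iE.
rewrite [in leRHS]iE vq_dual // -natrB // ler_wpDr ?vq_ge0 // ler_nat.
by move: g_i i_2g; lia.
Qed.

Lemma ordinary_slopes : ~~ (p %| `|(L`_g)%R|)%N ->
  forall lam, newton_slope p q L lam -> lam = 0 \/ lam = 1.
Proof.
move=> pLg lam [i [j [ij Li0 Lj0 vj line]]].
have Lg0 : L`_g != 0 by apply: contraNneq pLg => ->; rewrite dvdn0.
have vg : v g = 0 by apply/eqP; rewrite vq_eq0.
have := line 0%N; rewrite L0 => /(_ isT); rewrite -L0 vq_0 sub0r => l0.
have := line g Lg0; rewrite vg => lg.
have := line g.*2 L2g_neq0; rewrite vq_2g => l2g.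
have vi0 := vq_ge0 L`_i; have vj0 := vq_ge0 L`_j.
have ijR : i%:R < j%:R :> rat by rewrite ltr_nat.
have j2g : j%:R <= 2 * g%:R :> rat by rewrite -natrM ler_nat mul2n coef_le.
have gE : g.*2%:R = 2 * g%:R :> rat by rewrite -mul2n natrM.
have i0R : 0 <= i%:R :> rat by [].
rewrite gE in l2g; move: vj l0 lg l2g vi0 vj0.
have [j_g|g_j] := leqP j g.
  have jgR : j%:R <= g%:R :> rat by rewrite ler_nat.
  move=> vj l0 lg l2g vi0 vj0; left; apply/eqP; rewrite eq_le; apply/andP; split; nra.
have gjR : g%:R < j%:R :> rat by rewrite ltr_nat.
have vj_ge := vq_ge (ltnW g_j) Lj0.
have [g_i|i_g] := leqP g i.
  have giR : g%:R <= i%:R :> rat by rewrite ler_nat.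
  have vi_ge := vq_ge g_i Li0.
  move=> vj l0 lg l2g vi0 vj0; right; apply/eqP; rewrite eq_le; apply/andP; split; nra.
have igR : i%:R < g%:R :> rat by rewrite ltr_nat.
(* An edge cannot pass over [g]: starting at height at least 0 and being at most 0 at [g], the line
   has slope at most 0, but at [j] it must reach height [j - g > 0]. *)
move=> vj l0 lg l2g vi0 vj0; exfalso; nra.
Qed.

(** The edge leaving the last point [(i, 0)] at height 0. Its slope is positive by the choice of
    [i], and at most [g / (2g - i)], the slope towards [(2g, g)], which is less than 1 because
    [i < g]. *)
Lemma nonordinary_slope : (p %| `|(L`_g)%R|)%N ->
  exists2 lam, newton_slope p q L lam & 0 < lam < 1.
Proof.
move=> pLg.
have ex_unit : exists i, ~~ (p %| `|(L`_i)%R|)%N.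
  by exists 0%N; rewrite L0 dvdn1 (gtn_eqF (prime_gt1 p_pr)).
have bound i : ~~ (p %| `|(L`_i)%R|)%N -> (i <= g.*2)%N.
  by move=> pLi; apply: coef_le; apply: contraNneq pLi => ->; rewrite dvdn0.
case: (ex_maxnP ex_unit bound) => i pLi max_i.
have Li0 : L`_i != 0 by apply: contraNneq pLi => ->; rewrite dvdn0.
have vi : v i = 0 by apply/eqP; rewrite vq_eq0.
have i_g : (i < g)%N.
  rewrite ltnNge; apply/negP => g_i; have := vq_ge g_i Li0; rewrite vi subr_le0 ler_nat => i_le.
  move: pLi; have -> : i = g by apply/eqP; rewrite eqn_leq i_le.
  by rewrite pLg.
pose J := 'I_(g.*2.+1).
pose ok (j : J) := (i < j)%N && (L`_j != 0).
pose slope (j : J) := v j / (j%:R - i%:R).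
have ok_2g : ok ord_max by rewrite /ok L2g_neq0 andbT /= (ltn_trans i_g) // -addnn -[X in (X < _)%N]addn0 ltn_add2l.
case: (@arg_minP _ _ J ord_max ok slope ok_2g) => j /andP[ij Lj0] min_j.
have ijR : i%:R < j%:R :> rat by rewrite ltr_nat.
have vj : 0 < v j.
  rewrite lt_neqAle vq_ge0 andbT eq_sym vq_eq0 // negbK.
  by apply/negPn/negP => /max_i; rewrite leqNgt ij.
exists (slope j).
  exists i, j; split => //.
    by rewrite vi add0r /slope divfK // subr_eq0 gt_eqF.
  move=> l Ll0; rewrite vi add0r; have [l_i|i_l] := leqP l i.
    rewrite (le_trans _ (vq_ge0 _)) // mulr_ge0_le0 ?subr_le0 ?ler_nat //.
    by rewrite divr_ge0 ?vq_ge0 // subr_ge0 ltW.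
  have l_lt : (l < g.*2.+1)%N by rewrite ltnS coef_le.
  have := min_j (Ordinal l_lt); rewrite /ok /= i_l Ll0 => /(_ isT).
  by rewrite [in X in _ <= X]/slope /= ler_pdivlMr // subr_gt0 ltr_nat.
rewrite divr_gt0 ?subr_gt0 //=; have := min_j _ ok_2g => /le_lt_trans; apply.
have igR : i%:R < g%:R :> rat by rewrite ltr_nat.
have gE : g.*2%:R = 2 * g%:R :> rat by rewrite -mul2n natrM.
have i0R : 0 <= i%:R :> rat by [].
have s0 : 0 < 2 * g%:R - i%:R :> rat by lra.
rewrite /slope /= vq_2g gE ltr_pdivrMr // mul1r; lra.
Qed.

Lemma slopes_ordinary :
  (forall lam, newton_slope p q L lam -> lam = 0 \/ lam = 1) <-> ~~ (p %| `|(L`_g)%R|)%N.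
Proof.
split=> [slopes|]; last exact: ordinary_slopes.
apply/negP => /nonordinary_slope[lam /slopes[] -> /andP[]]; by rewrite ltxx.
Qed.

End NewtonPolygon.

Lemma dvdp_intr (k : nzRingType) p (a : int) : p \in [pchar k] ->
  (p %| `|a|)%N = (a%:~R == 0 :> k).
Proof.
move=> charkp; rewrite (dvdn_pcharf charkp).
by case: a => n; rewrite // NegzE abszN mulrNz oppr_eq0.
Qed.

Lemma ordinary_hasse_witt (k : finFieldType) p g d (f : {poly k}) :
  p \in [pchar k] -> odd p -> (0 < g < p)%N -> d = g.*2.+1 \/ d = g.*2.+2 ->
  f \is monic -> size f = d.+1 -> separable_poly f ->
  ordinary p g f <-> \det (hasse_witt g p f) != 0.
Proof.
move=> charkp p_odd /[dup] g_p /andP[g0 gp] hd fmon szf f_sep.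
have p_pr := pcharf_prime charkp.
have k2 := odd_pchar_two charkp p_odd.
have d0 : d = d.-1.+1 by case: hd => ->.
rewrite d0 in szf hd; have [C CE] := exists_char_poly fmon szf.
rewrite -CE in f_sep; have LP := Lpoly_isLpoly k2 f_sep hd; rewrite CE in LP.
set L := Lpoly g C in LP.
have szL : size L = g.*2.+1 := size_Lpoly k2 f_sep hd.
have L0 : L`_0 = 1 := Lpoly_coef0 LP.
have [e e2 dual] := Lnum_dual k2 f_sep hd.
have qE : #|k| = (p ^ logn p #|k|)%N := card_pprimeChar charkp.
set r := logn p #|k| in qE.
have r0 : (0 < r)%N by rewrite -(ltn_exp2l _ _ (prime_gt1 p_pr)) -qE finNzRing_gt1.
have L_dual i : (i <= g)%N -> L`_(g.*2 - i) = e * ((p ^ r) ^ (g - i))%N%:Z * L`_i.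
  by move=> i_g; rewrite -qE !coef_Lpoly // dual.
have szf' : (size f <= g.*2.+3)%N by rewrite szf; case: hd => ->.
have HWq : (p %| `|(L`_g)%R|)%N = (\det (hasse_witt g p f) == 0).
  rewrite (dvdp_intr _ charkp) (Lpoly_mod charkp p_odd g_p szf' LP).
  rewrite mulf_eq0 signr_eq0 /= qE -(prednK r0).
  by rewrite (det_hasse_witt_pow _ _ charkp).
have := slopes_ordinary p_pr r0 g0 szL L0 e2 L_dual; rewrite -qE => slopesP.
rewrite -HWq; apply: iff_trans _ slopesP; split=> [[L' L'P slopes]|slopes]; last by exists L.
by rewrite -(Lpoly_uniq L'P LP).
Qed.

(** * The trinomial family *)

Lemma coef_prod_top (R : comNzRingType) (I : finType) (P : I -> {poly R}) (n : I -> nat) :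
  (forall i, size (P i) <= (n i).+1)%N ->
  (\prod_i P i)`_(\sum_i n i) = \prod_i (P i)`_(n i).
Proof.
move=> szP; pose ok (Q : {poly R}) m c := (size Q <= m.+1)%N /\ Q`_m = c.
suff [] : ok (\prod_i P i) (\sum_i n i)%N (\prod_i (P i)`_(n i)) by [].
apply: (big_ind3 ok) => [|Q1 m1 c1 Q2 m2 c2 [s1 <-] [s2 <-]|i _]; last by split.
  by split; rewrite ?size_poly1 ?coef1.
split.
  rewrite (leq_trans (size_mul_leq _ _)) // -subn1 leq_subLR (leq_trans (leq_add s1 s2)) //.
  by rewrite addSn addnS.
have m1_lt : (m1 < (m1 + m2).+1)%N by rewrite ltnS leq_addr.
rewrite coefM (bigD1 (Ordinal m1_lt)) //= addKn big1 ?addr0 // => i ne.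
have [i_m|m_i] := ltnP i m1; last first.
  by rewrite nth_default ?mul0r // (leq_trans s1) // ltn_neqAle m_i andbT eq_sym.
rewrite [X in _ * X]nth_default ?mulr0 // (leq_trans s2) // ltn_subRL.
by rewrite ltn_add2r.
Qed.

(** With degree bounds by row, every term of the Leibniz expansion has the same total bound, so the
    extreme coefficients again form a determinant. *)
Lemma coef_det_rows (R : comNzRingType) g (M : 'M[{poly R}]_g) (n : 'I_g -> nat) :
  (forall i j, size (M i j) <= (n i).+1)%N ->
  (\det M)`_(\sum_i n i) = \det (\matrix_(i, j) (M i j)`_(n i)).
Proof.
move=> szM; rewrite /determinant coef_sum; apply: eq_bigr => s _.
under [in RHS]eq_bigr do rewrite mxE.
rewrite -coef_prod_top //.
by case: (odd_perm s); rewrite ?expr1 ?expr0 ?mulN1r ?mul1r ?coefN.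
Qed.

Section Trinomial.

Variables (R : comNzRingType) (d : nat) (a t : R).
Hypothesis d_gt1 : (1 < d)%N.

Let size_tail : (size (a *: 'X + t%:P)%R <= 2)%N.
Proof.
rewrite (leq_trans (size_polyD _ _)) // geq_max (leq_trans (size_scale_leq _ _)) ?size_polyX //.
by rewrite (leq_trans (size_polyC_leq1 _)).
Qed.

Lemma size_trinomial : size (trinomial d a t) = d.+1.
Proof. by rewrite /trinomial -addrA size_polyDl size_polyXn // (leq_ltn_trans size_tail). Qed.

Lemma trinomial_monic : trinomial d a t \is monic.
Proof.
rewrite monicE /trinomial -addrA lead_coefDl ?lead_coefXn // size_polyXn.
by rewrite (leq_ltn_trans size_tail).
Qed.

End Trinomial.

Lemma map_trinomial (R S : comNzRingType) (phi : {rmorphism R -> S}) d a t :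
  map_poly phi (trinomial d a t) = trinomial d (phi a) (phi t).
Proof.
by rewrite /trinomial !rmorphD /= map_polyXn map_polyZ map_polyX map_polyC.
Qed.

Lemma coef_exp_trinomial (R : comNzRingType) d (a : R) N e n :
  ((trinomial d a%:P 'X ^+ N)`_e)`_n
  = if (n <= N)%N then (('X^d + a *: 'X) ^+ (N - n))`_e *+ 'C(N, n) else 0.
Proof.
set G := 'X^d + a *: 'X.
(* The constant coefficient ['X%:P] is the parameter [t]; [G] collects the terms free of [t], and
   the binomial theorem separates the two. *)
have -> : trinomial d a%:P 'X = map_poly polyC G + 'X%:P.
  by rewrite rmorphD /= map_polyXn map_polyZ map_polyX.
rewrite exprDn coef_sum coef_sum.
under eq_bigr do rewrite coefMn coefMn -rmorphXn -[_ ^+ _ in X in _ * X]rmorphXn /= coefMC coef_map /= coefCM coefXn.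
case: leqP => [n_N|N_n].
  rewrite (bigD1 (Ordinal (n_N : n < N.+1)%N)) //= eqxx mulr1 big1 ?addr0 // => i ne.
  by rewrite [n == _](_ : _ = false) ?mulr0 ?mul0rn //; apply/negP => /eqP ni; case/eqP: ne; apply: val_inj.
by rewrite big1 // => i _; rewrite gtn_eqF ?mulr0 ?mul0rn // (leq_trans _ N_n) // ltnS -ltnS.
Qed.

(** As [X^d + a X = X (X^(d-1) + a)], the exponents in its powers decrease from the top one in steps
    of [d - 1]. *)
Lemma coef_exp_gap (R : comNzRingType) d (a : R) u del : (0 < u)%N -> (0 < del < d.-1)%N ->
  (('X^d + a *: 'X) ^+ u)`_(d * u - del) = 0.
Proof.
move=> u0 /andP[del0 del_d]; have d0 : (0 < d)%N by case: d del_d.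
have -> : 'X^d + a *: 'X = 'X * (('X + a%:P) \Po 'X^(d.-1)).
  rewrite comp_polyD comp_polyX comp_polyC mulrDr -exprS prednK //.
  by rewrite mulrC mul_polyC.
rewrite exprMn -rmorphXn /= mulrC coefMXn coef_comp_poly_Xn; last by rewrite (leq_ltn_trans _ del_d).
case: ltnP => // le_u; rewrite ifN //; apply/negP => dv.
have E : (d * u - del - u + del = d.-1 * u)%N.
  by move: le_u u0 del0 del_d; rewrite -(prednK d0) /= mulSn; lia.
have := dvdn_mulr u (dvdnn d.-1); rewrite -E dvdn_addr // gtnNdvd //.
Qed.

Lemma prime_bin_neq0 p N n : prime p -> (N < p)%N -> (n <= N)%N -> ~~ (p %| 'C(N, n))%N.
Proof.
move=> p_pr N_p n_N; apply/negP => pC.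
have : (p %| N`!)%N by rewrite -(bin_fact n_N) dvdn_mulr.
elim: N N_p {n_N pC} => [|N IHN] N_p; first by rewrite fact0 dvdn1 gtn_eqF ?prime_gt1.
by rewrite factS Euclid_dvdM // gtnNdvd //=; apply: IHN; apply: ltnW.
Qed.

(* For [p = m d + 1] the highest power of [t] in row [i] is [t^((p-1)/2 - (i+1) m)]
   and it occurs on the diagonal only. *)
Lemma det_hasse_witt_trinomial (F : idomainType) (a : F) p g d m :
  p \in [pchar F] -> odd p -> p = (m * d).+1 -> (0 < m)%N -> (g.*2 < d)%N -> (0 < g)%N ->
  \det (hasse_witt g p (trinomial d a%:P 'X)) != 0.
Proof.
move=> charFp p_odd pE m0 gd g0; have p_pr := pcharf_prime charFp.
set N := p.-1./2; have NE : (N.*2 = m * d)%N by rewrite /N half_pred_odd // pE.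
pose n (i : 'I_g) := (N - i.+1 * m)%N.
have im_N (i : 'I_g) : (i.+1 * m <= N)%N.
  by rewrite -leq_double NE -muln2 mulnAC muln2 mulnC leq_mul2l (leq_trans _ gd) ?orbT // ltnW // ltnS leq_double.
have N_p : (N < p)%N by rewrite -ltn_double NE pE; lia.
have entry (i j : 'I_g) c : ((hasse_witt g p (trinomial d a%:P 'X)) i j)`_c
    = if (c <= N)%N then (('X^d + a *: 'X) ^+ (N - c))`_(i.+1 * p - j.+1) *+ 'C(N, c) else 0.
  by rewrite mxE coef_exp_trinomial.
have d_gt2 : (2 < d)%N by move: gd g0; lia.
have szG1 : (size ('X^d + a *: 'X)%R <= d.+1)%N.
  rewrite (leq_trans (size_polyD _ _)) // geq_max size_polyXn leqnn.
  by rewrite (leq_trans (size_scale_leq _ _)) // size_polyX ltnW // ltnW // ltnW.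
have szG u : (size (('X^d + a *: 'X) ^+ u)%R <= (d * u).+1)%N.
  by rewrite (leq_trans (size_poly_exp_leq _ _)) // ltnS leq_mul2r; apply/orP; right; move: szG1; lia.
have eE (i j : 'I_g) : (i.+1 * p - j.+1 = d * (i.+1 * m) + i.+1 - j.+1)%N.
  by rewrite pE mulnS [(d * _)%N]mulnC -mulnA; congr (_ - _)%N; apply: addnC.
have i_d (i : 'I_g) : (i < d.-1)%N by have := ltn_ord i; move: gd; lia.
(* With [u = (i+1) m] the exponent is [d u + (i - j)]. In the [u]-th power of [X^d + a X] this is
   the top degree for [j = i], beyond the degree for [j < i], and inside the gap for [j > i]. *)
have top (i j : 'I_g) : ((hasse_witt g p (trinomial d a%:P 'X)) i j)`_(n i)
   = if i == j then 'C(N, n i)%:R else 0.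
  rewrite entry leq_subr subKn //; set u := (i.+1 * m)%N; rewrite eE.
  have u0 : (0 < u)%N by rewrite muln_gt0.
  case: eqP => [<-|/eqP ij].
    by rewrite addnK coef_exp_top // coefD coefXn eqxx coefZ coefX gtn_eqF ?mulr0 ?addr0 ?expr1n // ltnW.
  case: (ltngtP i j) => [lt_ij|gt_ij|e]; last by case/eqP: ij; apply: val_inj.
    have -> : (d * u + i.+1 - j.+1 = d * u - (j - i))%N by move: lt_ij; lia.
    by rewrite coef_exp_gap ?mul0rn // subn_gt0 lt_ij (leq_ltn_trans (leq_subr _ _)).
  rewrite nth_default ?mul0rn // (leq_trans (szG u)) //.
  by move: gt_ij; lia.
(* A higher power of [t] leaves an exponent at most [u - 1] for [X^d + a X], whose degree drops by
   at least [d], below [d u + (i - j)]. *)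
have sz (i j : 'I_g) : (size ((hasse_witt g p (trinomial d a%:P 'X)) i j) <= (n i).+1)%N.
  apply/leq_sizeP => c ni_c; rewrite entry; case: leqP => // c_N.
  rewrite nth_default ?mul0rn // (leq_trans (szG _)) // eE.
  have lt_u : (N - c < i.+1 * m)%N by move: (im_N i) ni_c c_N; rewrite /n; lia.
  have : (d * (N - c).+1 <= d * (i.+1 * m))%N by rewrite leq_mul2l lt_u orbT.
  by have := i_d j; move: d_gt2; rewrite mulnS; lia.
apply: contraTneq isT => det0.
have := coef_det_rows sz; rewrite det0 coef0 => /esym/eqP.
have -> : \matrix_(i, j) ((hasse_witt g p (trinomial d a%:P 'X)) i j)`_(n i)
    = diag_mx (\row_i 'C(N, n i)%:R) :> 'M[F]_g.
  by apply/matrixP => i j; rewrite mxE top !mxE; case: eqP => [->|]; rewrite ?mulr1n ?mulr0n.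
rewrite det_diag; apply: contraLR => _; apply/prodf_neq0 => i _; rewrite mxE -(dvdn_pcharf charFp).
by rewrite prime_bin_neq0 // leq_subr.
Qed.

(** * Residue fields of rings of integers *)

Section FiniteDomain.

Variables (R : comNzRingType) (s : seq R).

(** An alias of [R] whose type carries the two properties, so that instances can depend on them and
    the identity is the morphism to the field. *)
Definition finite_domain of (forall x y : R, x * y = 0 -> (x == 0) || (y == 0))
  & (forall x, x \in s) : Type := R.

Hypothesis domR : forall x y : R, x * y = 0 -> (x == 0) || (y == 0).
Hypothesis mem_s : forall x : R, x \in s.
Local Notation T := (finite_domain domR mem_s).

HB.instance Definition _ := GRing.ComNzRing.on T.

Fact finite_domain_countP : pcancel (fun x : T => index x s) (onth s).
Proof. by move=> x; rewrite onthE (nth_map 0) ?index_mem ?mem_s // nth_index ?mem_s. Qed.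

HB.instance Definition _ := Countable.copy T (pcan_type finite_domain_countP).

Fact finite_domain_enumP : Finite.axiom (undup (s : seq T)).
Proof. by move=> x; rewrite count_uniq_mem ?undup_uniq // mem_undup mem_s. Qed.

HB.instance Definition _ := isFinite.Build T finite_domain_enumP.

Definition finite_domain_inv (x : T) : T :=
  if x == 0 then 0 else odflt 0 [pick y | y * x == 1].

Fact finite_domain_mulVf (x : T) : x != 0 -> finite_domain_inv x * x = 1.
Proof.
move=> x0; rewrite /finite_domain_inv (negPf x0); case: pickP => /= [y /eqP //|none].
have inj : injective (fun y : T => y * x).
  move=> y z /eqP; rewrite -subr_eq0 -mulrBl => /eqP/domR.
  by rewrite (negPf x0) orbF subr_eq0 => /eqP.
have /codomP[y yx] := injF_onto inj 1.
by have := none y; rewrite -yx eqxx.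
Qed.

Fact finite_domain_inv0 : finite_domain_inv 0 = 0.
Proof. by rewrite /finite_domain_inv eqxx. Qed.

HB.instance Definition _ :=
  GRing.ComNzRing_isField.Build T finite_domain_mulVf finite_domain_inv0.

Lemma finite_domain_field : exists k : finFieldType, inhabited {rmorphism R -> k}.
Proof. by exists T; constructor; exact: (idfun : {rmorphism R -> R}). Qed.

End FiniteDomain.

Section FiniteQuotient.

Variables (R : comNzRingType) (p : nat).
Hypotheses (p_pr : prime p) (p0 : p%:R = 0 :> R).

(** Stated with integer coefficients, so that a relation in [F] can be carried over to a quotient of
    its ring of integers. *)
Definition dependent n (x : 'I_n -> R) :=
  exists2 z : 'I_n -> int, \sum_i (z i)%:~R * x i = 0 & exists i, ~~ (p %| z i)%Z.

Lemma intr_modz (a : int) : a%:~R = (`|(a %% p)%Z|)%:R :> R.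
Proof.
rewrite {1}(divz_eq a p) rmorphD rmorphM /= -[p%:Z%:~R]/(p%:R) p0 mulr0 add0r.
by rewrite -[RHS]/((`|(a %% p)%Z|%:Z)%:~R) gez0_abs // modz_ge0 // eqz_nat -lt0n prime_gt0.
Qed.

(** If some [n]-tuple is independent, it spans [R] over the field with [p] elements, and
    coefficients in [0, ..., p-1] give a finite list; otherwise [n] can be lowered. *)
Lemma finite_of_dependent n : (forall x : 'I_n -> R, dependent x) ->
  exists s : seq R, forall x, x \in s.
Proof.
elim: n => [|n IHn] dep.
  by have [z _ [[]]] := dep (fun=> 0).
have [/IHn // | /boolp.existsNP[x x_ind]] := boolp.pselect (forall x : 'I_n -> R, dependent x).
exists [seq \sum_i (nat_of_ord (c i))%:R * x i | c : {ffun 'I_n -> 'I_p}] => y.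
have [z zy [i zi]] := dep (fun j => if unlift ord_max j is Some j' then x j' else y).
rewrite big_ord_recr /= unlift_none in zy.
have wl j : widen_ord (leqnSn n) j = lift ord_max j by apply: val_inj; exact: esym (lift_max j).
have zE : \sum_(j < n) (z (widen_ord (leqnSn n) j))%:~R * x j = - ((z ord_max)%:~R * y).
  apply/eqP; rewrite -addr_eq0 -[X in _ == X]zy; apply/eqP; congr (_ + _).
  apply: eq_bigr => j _; congr (_ * _).
  by rewrite wl liftK.
(* Otherwise the term in [y] vanishes and the relation is one between the [x i]. *)
have pz : ~~ (p %| z ord_max)%Z.
  apply/negP => pz; apply: x_ind; exists (fun j => z (widen_ord (leqnSn n) j)).
    rewrite zE; move/dvdzP: pz => [w ->].
    by rewrite rmorphM /= -[p%:Z%:~R]/(p%:R) p0 mulr0 mul0r oppr0.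
  case: (unliftP ord_max i) => [j ij|ij]; last by rewrite ij pz in zi.
  by exists j; rewrite wl -ij.
have [[u w] uw] : exists uw : int * int, uw.1 * z ord_max + uw.2 * p = 1.
  have := Bezoutz (z ord_max) p => -[u [w uw]]; exists (u, w); rewrite /= uw.
  have : coprimez p (z ord_max).
    by rewrite /coprimez /gcdz eqz_nat -[_ == _]/(coprime p `|z ord_max|) prime_coprime.
  by rewrite coprimez_sym => /eqP.
have uz : u%:~R * (z ord_max)%:~R = 1 :> R.
  have := congr1 (fun a : int => a%:~R : R) uw.
  by rewrite /= rmorphD !rmorphM /= -[p%:Z%:~R]/(p%:R) p0 mulr0 addr0.
pose c j : int := - u * z (widen_ord (leqnSn n) j).
have c_lt j : (`|(c j %% p)%Z| < p)%N.
  have p1 : (0 : int) < p by rewrite ltz_nat prime_gt0.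
  by have := ltz_pmod (c j) p1; rewrite -ltz_nat gez0_abs // modz_ge0 // gt_eqF.
apply/mapP; exists [ffun j => Ordinal (c_lt j)]; first by rewrite mem_enum.
have {1}-> : y = - (u%:~R * \sum_(j < n) (z (widen_ord (leqnSn n) j))%:~R * x j).
  by rewrite zE mulrN opprK mulrA uz mul1r.
rewrite mulr_sumr -sumrN; apply: eq_bigr => j _.
by rewrite ffunE /= -intr_modz /c rmorphM rmorphN /= mulrA mulNr mulNr.
Qed.

End FiniteQuotient.

Section IntegralDependence.

Variables (F : fieldExtType rat) (p : nat).
Hypothesis p_pr : prime p.

Lemma exists_int_dependence m (x : 'I_m -> F) : (\dim {:F} < m)%N ->
  exists2 z : 'I_m -> int, \sum_i (z i)%:~R * x i = 0 & exists i, z i != 0.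
Proof.
move=> dim_m; pose X := [tuple x i | i < m].
have not_free : ~~ free X.
  by apply/negP; rewrite /free size_tuple => /eqP e; move: dim_m; rewrite -e ltnNge dimvS ?subvf.
have [c [cx [i ci]]] : exists c : 'I_m -> rat, \sum_i c i *: x i = 0 /\ exists i, c i != 0.
  have [c /boolp.not_implyP[cx /boolp.existsNP[i /eqP ci]]] : exists c : 'I_m -> rat,
      ~ (\sum_(i < m) c i *: X`_i = 0 -> forall i, c i = 0) 
    by apply/boolp.existsNP => H; move/negP: not_free; apply; apply/freeP.
  exists c; split; last by exists i.
  by rewrite -[RHS]cx; apply: eq_bigr => j _; rewrite nth_mktuple.
pose D := \prod_j denq (c j).
have D0 : D != 0 by apply/prodf_neq0 => j _; apply: denq_neq0.
pose z j := numq (c j) * \prod_(l | l != j) denq (c l).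
have zE j : (z j)%:~R = D%:~R * c j :> rat.
  rewrite /z /D [X in _ = X%:~R * _](bigD1 j) //= !intrM.
  rewrite [RHS]mulrAC -[X in _ = _ * X * _]divq_num_den.
  by congr (_ * _); rewrite [RHS]mulrC divfK ?intr_eq0 ?denq_neq0.
exists z.
  have -> : \sum_j (z j)%:~R * x j = D%:~R *: \sum_j c j *: x j.
    rewrite scaler_sumr; apply: eq_bigr => j _.
    by rewrite scalerA -zE scaler_int mulrzl.
  by rewrite cx scaler0.
by exists i; rewrite -(intr_eq0 rat) zE mulf_neq0 ?intr_eq0.
Qed.

(** Common factors [p] are divided out, which [F] permits in characteristic 0; the absolute value of
    a nonzero coefficient decreases. *)
Lemma exists_primitive_dependence m (x : 'I_m -> F) : (\dim {:F} < m)%N ->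
  dependent p x.
Proof.
move=> dim_m; have [z zx [i zi]] := exists_int_dependence x dim_m.
have [n] := ubnP `|z i|%N; elim: n z zx zi => // n IHn z zx zi zi_n.
have [/forallP pz|] := boolP [forall j, (p %| z j)%Z]; last first.
  by rewrite negb_forall => /existsP; exists z.
have p0 : p%:R != 0 :> F by rewrite -(rmorph_nat (in_alg F)) fmorph_eq0 pnatr_eq0 -lt0n prime_gt0.
have zE j : z j = (z j %/ p)%Z * p by rewrite divzK.
apply: (IHn (fun j => (z j %/ p)%Z)).
- apply: (mulfI p0); rewrite mulr0 mulr_sumr -[RHS]zx; apply: eq_bigr => j _.
  by rewrite [in RHS]zE rmorphM /= mulrA; congr (_ * _); rewrite mulrC.
- by apply: contraNneq zi => zi0; rewrite zE zi0 mul0r.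
rewrite -ltnS (leq_trans _ zi_n) // ltnS [in X in (_ < X)%N]zE abszM ltn_Pmulr ?prime_gt1 //.
by rewrite absz_gt0; apply: contraNneq zi => zi0; rewrite zE zi0 mul0r.
Qed.

End IntegralDependence.

Lemma residue_field_finite (F : fieldExtType rat) (P : prime_idealr (ring_of_integers F)) p :
  prime p -> (p%:R : ring_of_integers F) \in (P : {pred ring_of_integers F}) ->
  exists k : finFieldType, inhabited {rmorphism {ideal_quot P} -> k}.
Proof.
move=> p_pr pP.
have p0 : p%:R = 0 :> {ideal_quot P}.
  rewrite -(rmorph_nat (residue P)) -(rmorph0 (residue P)).
  by apply/eqP; rewrite /residue -Quotient.idealrBE subr0.
have dep (x : 'I_(\dim {:F}).+1 -> {ideal_quot P}) : dependent p x.
  have [z zx zi] := exists_primitive_dependence p_pr (fun i => roi_val (repr (x i))) (ltnSn _).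
  exists z => //; have zx' : \sum_i (z i)%:~R * repr (x i) = 0 :> ring_of_integers F.
    apply: val_inj; rewrite rmorph_sum rmorph0 -[RHS]zx; apply: eq_bigr => i _.
    by rewrite rmorphM rmorph_int.
  pose rho : {rmorphism ring_of_integers F -> {ideal_quot P}} := residue P.
  have := congr1 rho zx'; rewrite rmorph_sum rmorph0 => zy.
  rewrite -[RHS]zy; apply: eq_bigr => i _.
  by rewrite rmorphM rmorph_int /= /residue reprK.
have [s sP] := finite_of_dependent p_pr p0 dep.
by apply: finite_domain_field sP; apply: Quotient.rquot_IdomainAxiom.
Qed.

(** * Specialization of t and conclusion *)

Lemma horner_disc_family (R : comNzRingType) (k : fieldType) (phi : {rmorphism R -> k})
    d (a : R) (t : k) : (1 < d)%N -> (d%:R : k) != 0 ->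
  ((map_poly phi (disc_family d a)).[t] != 0)
  = separable_poly (trinomial d (phi a) t).
Proof.
move=> d1 dk; pose ev : {rmorphism {poly R} -> k} := horner_eval t \o map_poly phi.
have evE h : ev h = (map_poly phi h).[t] by [].
set T := trinomial d a%:P 'X; set f := trinomial d (phi a) t.
have Tf : map_poly ev T = f.
  by rewrite map_trinomial !evE map_polyC map_polyX hornerC hornerX.
have lcT : ev (lead_coef T) != 0.
  by rewrite (monicP (trinomial_monic _ _ d1)) rmorph1 oner_neq0.
(* The resultant commutes with specialization when both leading coefficients survive. That of the
   derivative is [d], which is invertible in [k]. *)
have lcT' : ev (lead_coef T^`()) != 0.
  have T'd : (T^`())`_d.-1 = d%:R.
    rewrite coef_deriv prednK 1?ltnW // !coefD coefXn eqxx coefZ coefX gtn_eqF // mulr0.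
    by rewrite coefC gtn_eqF ?addr0 // ltnW.
  have dR : (d%:R : {poly R}) != 0.
    by apply: contraNneq dk => d0; rewrite -(rmorph_nat ev) d0 rmorph0.
  have szT' : size T^`() = d.
    apply/eqP; rewrite eqn_leq; apply/andP; split.
      by rewrite -ltnS -(size_trinomial a%:P 'X d1) lt_size_deriv // monic_neq0 ?trinomial_monic.
    rewrite -[X in (X <= _)%N](prednK (ltnW d1)) ltnNge; apply/negP => sz.
    by move/eqP: T'd; rewrite nth_default // eq_sym (negPf dR).
  by rewrite /lead_coef szT' T'd rmorph_nat.
rewrite -[(map_poly phi _).[t]]/(ev (disc_family d a)) /disc_family /discriminant.
rewrite rmorphM rmorph_sign map_resultant // Tf -deriv_map Tf.
rewrite mulf_eq0 signr_eq0 /= resultant_eq0 -leqNgt unlock coprimep_def eqn_leq.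
by rewrite size_poly_gt0 gcdp_eq0 negb_and monic_neq0 ?trinomial_monic ?andbT.
Qed.

(** The derivative does not involve [t], so a multiple root [x] is one of fewer than [d] elements,
    and it determines [t = -(x^d + a x)]. A large extension has a [t] avoiding these values and the
    roots of [h]. *)
Lemma exists_separable_trinomial (k : finFieldType) d (a : k) (h : {poly k}) :
  (1 < d)%N -> (d%:R : k) != 0 -> h != 0 ->
  exists (kn : finFieldType) (iota : {rmorphism k -> kn}) (t : kn),
    (map_poly iota h).[t] != 0 /\ separable_poly (trinomial d (iota a) t).
Proof.
move=> d1 dk h0.
have [kn [iota knE]] := finField_extension k (ltn0Sn (d + size h)).
have [K [emb _]] := countable_algebraic_closure kn.
exists kn, iota; set b := iota a.
pose f t := trinomial d b t.
have fE t : map_poly emb (f t) = trinomial d (emb b) (emb t) by rewrite map_trinomial.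
have derivE t : (f t)^`() = (f 0)^`() by rewrite !derivD !derivC.
have dkn : (d%:R : kn) != 0 by rewrite -(rmorph_nat iota) fmorph_eq0.
have sz_deriv : (size ((f 0)^`())%R <= d)%N.
  by rewrite -ltnS -(size_trinomial b 0 d1) lt_size_deriv // monic_neq0 ?trinomial_monic.
have deriv0 : (f 0)^`() != 0.
  apply/eqP => e; have := congr1 (fun u : {poly kn} => u`_d.-1) e; rewrite /= coef0 coef_deriv prednK 1?ltnW //.
  rewrite !coefD coefXn eqxx coefZ coefX gtn_eqF // mulr0 coefC gtn_eqF 1?ltnW // !addr0.
  by move/eqP; rewrite (negPf dkn).
have [xs xsE] := closed_field_poly_normal (map_poly emb (f 0)^`()).
have lc0 : lead_coef (map_poly emb (f 0)^`()) != 0 by rewrite lead_coef_eq0 map_poly_eq0.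
have sz_xs : (size xs < d)%N.
  by move: sz_deriv; rewrite -(size_map_poly emb) xsE size_scale // size_prod_XsubC.
pose bad x := - (x ^+ d + emb b * x).
pose B := (\prod_(z <- map bad xs) ('X - z%:P)) * map_poly emb (map_poly iota h).
have B0 : B != 0.
  by rewrite mulf_neq0 ?map_poly_eq0 // monic_neq0 ?monic_prod_XsubC.
have szB : (size B <= d + size h)%N.
  rewrite (leq_trans (size_mul_leq _ _)) // size_prod_XsubC size_map !size_map_poly.
  by rewrite addSn /= leq_add2r ltnW.
have [/forallP allB|] := boolP [forall t : kn, root B (emb t)].
  have : (size [seq emb t | t : kn] < size B)%N.
    apply: max_poly_roots => //; first by apply/allP => _ /mapP[t _ ->].
    by rewrite map_inj_uniq ?enum_uniq //; apply: fmorph_inj.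
  rewrite size_map -cardE knE ltnNge (leq_trans szB) //.
  by rewrite (leq_trans (leqnSn _)) // ltnW // ltn_expl // finNzRing_gt1.
rewrite negb_forall => /existsP[t]; rewrite rootM negb_or root_prod_XsubC => /andP[t_bad ht].
exists t; split; first by move: ht; rewrite /root horner_map fmorph_eq0.
rewrite unlock; apply/negPn/negP => ncop; case/negP: t_bad.
have [x] : exists x, root (map_poly emb (gcdp (f t) (f t)^`())) x.
  by apply/closed_rootP; rewrite size_map_poly.
rewrite gcdp_map root_gcd derivE xsE rootZ // root_prod_XsubC => /andP[fx x_xs].
apply/mapP; exists x => //; apply/eqP; rewrite -addr_eq0 addrC; move: fx; rewrite fE.
by rewrite /root /trinomial !hornerE.
Qed.

Theorem corollary1p6 (g d : nat) (hg : (2 <= g)%N)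
    (hd : d = g.*2.+1 \/ d = g.*2.+2)
    (F : fieldExtType rat) (alpha : ring_of_integers F)
    (hF : <<1; (alpha : F)>>%VS = fullv)
    (p : nat) (hp : prime p) (hpd : p = 1 %[mod d])
    (P : prime_idealr (ring_of_integers F))
    (hP : (p%:R : ring_of_integers F) \in (P : {pred ring_of_integers F})) :
  generically_ordinary d alpha P p g.
Proof.
have gd : (g.*2 < d)%N by case: hd => ->.
have g0 : (0 < g)%N by apply: ltnW.
have d1 : (1 < d)%N by move: gd hg; lia.
pose m := (p %/ d)%N; have pE : p = (m * d).+1.
  by rewrite {1}(divn_eq p d) hpd modn_small // addn1.
have m0 : (0 < m)%N.
  by rewrite lt0n; apply: contraTneq (prime_gt1 hp) => m0; rewrite pE m0.
have d_p : (d < p)%N by rewrite pE ltnS leq_pmull.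
have g_p : (0 < g < p)%N.
  by rewrite g0 (leq_trans _ d_p) // ltnS (leq_trans _ (ltnW gd)) // -addnn leq_addr.
have p_odd : odd p.
  by case: (even_prime hp) => // p2; move: d_p; rewrite p2 ltnNge d1.
pose rho : {rmorphism ring_of_integers F -> {ideal_quot P}} := residue P.
have p0 : p%:R = 0 :> {ideal_quot P}.
  rewrite -(rmorph_nat rho) -(rmorph0 rho).
  by apply/eqP; rewrite /= -Quotient.idealrBE subr0.
have char_red (k : finFieldType) (red : {rmorphism {ideal_quot P} -> k}) : p \in [pchar k].
  by rewrite inE hp -(rmorph_nat red) p0 rmorph0 eqxx.
have dk (k : finFieldType) : p \in [pchar k] -> (d%:R : k) != 0.
  by move=> charkp; rewrite -(dvdn_pcharf charkp) gtnNdvd // ltnW.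
have size_le (k : fieldType) (a t : k) : (size (trinomial d a t) <= g.*2.+3)%N.
  by rewrite size_trinomial //; case: hd => ->.
set abar := residue P alpha.
(* Formed over the quotient ring itself, so the same [h] defines the ordinary locus at every point
   of the fiber. *)
pose h : {poly {ideal_quot P}} := \det (hasse_witt g p (trinomial d abar%:P 'X)).
have hE (k : fieldType) (red : {rmorphism {ideal_quot P} -> k}) (t : k) :
    (map_poly red h).[t] = \det (hasse_witt g p (trinomial d (red abar) t)).
  pose ev : {rmorphism {poly {ideal_quot P}} -> k} := horner_eval t \o map_poly red.
  rewrite -[LHS]/(ev h) -det_map_mx hasse_witt_map map_trinomial /= /horner_eval.
  by rewrite map_polyC map_polyX hornerC hornerX.
have ordinaryE (s : fiber_point d alpha P) :
    ordinary p g (fiber_curve s) <-> (map_poly (pt_red s) h).[pt_t s] != 0.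
  rewrite hE; have charkp := char_red _ (pt_red s).
  apply: (ordinary_hasse_witt charkp p_odd g_p hd).
  - exact: trinomial_monic.
  - exact: size_trinomial.
  pose phi : {rmorphism ring_of_integers F -> pt_field s} := pt_red s \o rho.
  by rewrite -(horner_disc_family phi) ?dk //; apply: pt_disc.
split; first by exists h.
(* The quotient is mapped to a [finFieldType], over which [h] is still nonzero; a point of the fiber
   is then found over an extension of [k0]. *)
have [k0 [red]] := residue_field_finite hp hP.
have h0 : map_poly red h != 0.
  pose redX : {rmorphism {poly {ideal_quot P}} -> {poly k0}} := map_poly red.
  have -> : map_poly red h = \det (hasse_witt g p (trinomial d (red abar)%:P 'X)).
    by rewrite -[LHS]/(redX h) -det_map_mx hasse_witt_map map_trinomial /= map_polyC map_polyX.
  exact: det_hasse_witt_trinomial (char_red _ red) p_odd pE m0 gd g0.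
have [k [iota [t [ht f_sep]]]] := exists_separable_trinomial (red abar) d1 (dk _ (char_red _ red)) h0.
pose redk : {rmorphism {ideal_quot P} -> k} := iota \o red.
have charkp := char_red _ redk.
have k2 := odd_pchar_two charkp p_odd.
pose phi : {rmorphism ring_of_integers F -> k} := redk \o rho.
have disc : (map_poly (fun a => redk (residue P a)) (disc_family d alpha)).[t] != 0.
  by rewrite (horner_disc_family phi) ?dk.
exists (FiberPoint k2 disc); apply/ordinaryE => /=.
by rewrite map_poly_comp.
Qed.
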